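(* Let $R = k[x_1,\dots,x_n]$ be a polynomial ring over a field $k$. Let $I = J + fH$, where $J$ and $H$ are homogeneous ideals in $R$ and $f$ is any form of degree $d$ that is a non-zerodivisor of $R/J$. Then (i) $\operatorname{depth} R/I \in \{ \operatorname{depth} R/(J+H),\ \operatorname{depth} R/J - 1\}$; (ii) $\operatorname{reg} R/I \in \{\operatorname{reg} R/(J+H)+d,\ \operatorname{reg} R/J + d-1,\ \dots,\ \operatorname{reg} R/J\}$, i.e. $\operatorname{reg} R/I$ equals $\operatorname{reg} R/(J+H)+d$ or $\operatorname{reg} R/J+e$ for some integer $0\le e\le d-1$.
   Context: $R$ has the standard grading and $\mathfrak m=(x_1,\dots,x_n)$. For a finitely generated graded $R$-module $M$ with local cohomology modules $H^i_{\mathfrak m}(M)$, $\operatorname{depth} M := \min\{ i \mid H^i_{\mathfrak m}(M) \neq 0\}$ and $\operatorname{reg} M := \max\{i+j \mid H^i_{\mathfrak m}(M)_j \neq 0\}$ (Castelnuovo-Mumford regularity). By the usual convention the zero module has depth $+\infty$ and regularity $-\infty$. A form is a homogeneous polynomial. *)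

(* Defs.v *)
From HB Require Import structures.
From mathcomp Require Import all_boot all_order all_algebra.
From mathcomp Require Import mpoly.
From mathcomp Require Import boolp classical_sets constructive_ereal.
From mathcomp Require Import zify ring.

Set Implicit Arguments.
Unset Strict Implicit.
Unset Printing Implicit Defensive.

Import GRing.Theory.

Local Open Scope classical_set_scope.
Local Open Scope quotient_scope.
Local Open Scope ring_scope.

(* An ideal of R is a submodule of the regular module R^o; unlike the [idealr]
   of ring_quotient, it may be the unit ideal. *)
Section Submodules.
Context (R : comNzRingType) (V : lmodType R).

Definition submod_add_pred (N P : submodClosed V) : pred V :=
  fun v => `[< exists a b, [/\ a \in N, b \in P & v = a + b] >].

Lemma submod_add_closed N P : submod_closed (submod_add_pred N P).
Proof.
split=> [|a _ _ /asboolP[u [v [uN vP ->]]] /asboolP[u' [v' [uN' vP' ->]]]].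
  by apply/asboolP; exists 0, 0; rewrite addr0 !rpred0.
apply/asboolP; exists (a *: u + u'), (a *: v + v').
by rewrite !(rpredD, rpredZ) // scalerDr addrACA.
Qed.

HB.instance Definition _ N P := GRing.isSubmodClosed.Build R V
  (submod_add_pred N P) (submod_add_closed N P).

Definition submod_add N P : submodClosed V :=
  GRing.SubmodClosed.clone R V (submod_add_pred N P) _.

Definition submod_scale_pred (f : R) (N : submodClosed V) : pred V :=
  fun v => `[< exists2 a, a \in N & v = f *: a >].

Lemma submod_scale_closed f N : submod_closed (submod_scale_pred f N).
Proof.
split=> [|a _ _ /asboolP[u uN ->] /asboolP[v vN ->]]; apply/asboolP.
  by exists 0; rewrite ?rpred0 ?scaler0.
exists (a *: u + v); first by rewrite rpredD ?rpredZ.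
by rewrite scalerDr !scalerA mulrC.
Qed.

HB.instance Definition _ f N := GRing.isSubmodClosed.Build R V
  (submod_scale_pred f N) (submod_scale_closed f N).

Definition submod_scale f N : submodClosed V :=
  GRing.SubmodClosed.clone R V (submod_scale_pred f N) _.

(* In the library [submodClosed] does not inherit from [zmodClosed], which the
   quotient construction asks for. *)
Definition submod_pred (N : submodClosed V) : pred V := fun v => v \in N.

Lemma submod_pred_closed N : zmod_closed (submod_pred N).
Proof.
rewrite /submod_pred; split=> [|u v uN vN]; rewrite unfold_in ?rpred0 //.
by rewrite -scaleN1r rpredD ?rpredZ.
Qed.

HB.instance Definition _ N :=
  GRing.isZmodClosed.Build V (submod_pred N) (submod_pred_closed N).

Definition submod_zmod (N : submodClosed V) : zmodClosed V :=
  GRing.ZmodClosed.clone V (submod_pred N) _.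

Definition quotmod (N : submodClosed V) := Quotient.quot (submod_zmod N).

HB.instance Definition _ N := GRing.Zmodule.on (quotmod N).
HB.instance Definition _ N :=
  EqQuotient.copy (quotmod N) (Quotient.quot (submod_zmod N)).

Section QuotientModule.
Context (N : submodClosed V).
Local Notation Q := (quotmod N).

Definition quot_scale (a : R) (z : Q) : Q := \pi_Q (a *: repr z).

Lemma quot_eqP (u v : V) : reflect (\pi_Q u = \pi_Q v) (u - v \in N).
Proof. by rewrite (Quotient.idealrBE (submod_zmod N)); exact: eqP. Qed.

Lemma quot_piD (u v : V) : \pi_Q (u + v) = \pi_Q u + \pi_Q v.
Proof. exact: (@pi_addr _ _ _ _ _ (Quotient.quot (submod_zmod N)) u v). Qed.

Lemma quot_scaleE a (v : V) : quot_scale a (\pi_Q v) = \pi_Q (a *: v).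
Proof.
apply/quot_eqP; rewrite -scalerBr rpredZ //.
by apply/quot_eqP; rewrite reprK.
Qed.

Lemma quot_scaleA a b z : quot_scale a (quot_scale b z) = quot_scale (a * b) z.
Proof. by elim/quotW: z => v; rewrite (quot_scaleE b) !quot_scaleE scalerA. Qed.

Lemma quot_scale1 : left_id 1 quot_scale.
Proof. by elim/quotW=> v; rewrite quot_scaleE scale1r. Qed.

Lemma quot_scaleDr : right_distributive quot_scale +%R.
Proof.
move=> a; elim/quotW=> u; elim/quotW=> v.
by rewrite -quot_piD !quot_scaleE scalerDr quot_piD.
Qed.

Lemma quot_scaleDl z : {morph quot_scale^~ z : a b / a + b}.
Proof.
by elim/quotW: z => v a b; rewrite !quot_scaleE scalerDl quot_piD.
Qed.

HB.instance Definition _ := GRing.Zmodule_isLmodule.Build R (quotmod N)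
  quot_scaleA quot_scale1 quot_scaleDr quot_scaleDl.

End QuotientModule.
End Submodules.

Definition nonzerodivisor (R : comNzRingType) (M : lmodType R) (f : R) :=
  forall z : M, f *: z = 0 -> z = 0.

(* The localisation M_s of M at the powers of s. *)
Section Localization.
Context (R : comNzRingType) (M : lmodType R) (s : R).

(* m/s^a = m'/s^b *)
Definition loc_equiv (p q : M * nat) : bool :=
  `[< exists u, s ^+ (u + q.2) *: p.1 = s ^+ (u + p.2) *: q.1 >].

Lemma loc_equiv_is_equiv : equiv_class_of loc_equiv.
Proof.
split=> [p|p q|q p r].
- by apply/asboolP; exists 0%N.
- by apply/asboolP/asboolP => -[u e]; exists u.
move=> /asboolP[u e] /asboolP[v e']; apply/asboolP.
exists (u + v + q.2)%N.
have -> : (u + v + q.2 + r.2 = (v + r.2) + (u + q.2))%N by lia.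
have -> : (u + v + q.2 + p.2 = (u + p.2) + (v + q.2))%N by lia.
by rewrite exprD -scalerA e scalerA mulrC -scalerA e' scalerA -exprD.
Qed.

Canonical loc_equiv_equiv := EquivRelPack loc_equiv_is_equiv.
Canonical loc_equiv_encModRel := defaultEncModRel loc_equiv.

Definition loc := {eq_quot loc_equiv}.

HB.instance Definition _ := EqQuotient.on loc.
HB.instance Definition _ := Choice.on loc.

(* m / s^a *)
Definition loc_frac (m : M) (a : nat) : loc := \pi_loc (m, a).

Lemma frac_eqP m a m' a' :
  loc_frac m a = loc_frac m' a' <->
  exists u, s ^+ (u + a') *: m = s ^+ (u + a) *: m'.
Proof.
split=> [/eqP|e]; first by rewrite piE => /asboolP.
by apply/eqP; rewrite piE; apply/asboolP.
Qed.

Lemma loc_ind (P : loc -> Prop) :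
  (forall m a, P (loc_frac m a)) -> forall z, P z.
Proof. by move=> Pfrac; elim/quotW=> -[m a]; exact: Pfrac. Qed.

Lemma frac_repr (z : loc) : loc_frac (repr z).1 (repr z).2 = z.
Proof. by rewrite /loc_frac -surjective_pairing reprK. Qed.

Definition loc_zero : loc := loc_frac 0 0.
Definition loc_opp (z : loc) : loc := loc_frac (- (repr z).1) (repr z).2.
Definition loc_add (y z : loc) : loc :=
  loc_frac (s ^+ (repr z).2 *: (repr y).1 + s ^+ (repr y).2 *: (repr z).1)
       ((repr y).2 + (repr z).2).
Definition loc_scale (r : R) (z : loc) : loc :=
  loc_frac (r *: (repr z).1) (repr z).2.

Lemma loc_oppE m a : loc_opp (loc_frac m a) = loc_frac (- m) a.
Proof.
have /frac_eqP[u e] := frac_repr (loc_frac m a); apply/frac_eqP; exists u.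
by rewrite !scalerN e.
Qed.

Lemma loc_scaleE r m a : loc_scale r (loc_frac m a) = loc_frac (r *: m) a.
Proof.
have /frac_eqP[u e] := frac_repr (loc_frac m a); apply/frac_eqP; exists u.
by rewrite scalerA mulrC -scalerA e !scalerA mulrC.
Qed.

Lemma loc_addE m a m' a' :
  loc_add (loc_frac m a) (loc_frac m' a')
  = loc_frac (s ^+ a' *: m + s ^+ a *: m') (a + a').
Proof.
have /frac_eqP[u] := frac_repr (loc_frac m a).
have /frac_eqP[v] := frac_repr (loc_frac m' a').
rewrite /loc_add; set y := repr (loc_frac m a).
set z := repr (loc_frac m' a') => e' e.
apply/frac_eqP; exists (u + v)%N; rewrite !scalerDr !scalerA -!exprD.
have -> : (u + v + (a + a') + z.2 = (v + a' + z.2) + (u + a))%N by lia.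
have -> : (u + v + (y.2 + z.2) + a' = (v + a' + z.2) + (u + y.2))%N by lia.
have -> : (u + v + (a + a') + y.2 = (u + a + y.2) + (v + a'))%N by lia.
have -> : (u + v + (y.2 + z.2) + a = (u + a + y.2) + (v + z.2))%N by lia.
rewrite ![s ^+ (v + a' + z.2 + _)]exprD ![s ^+ (u + a + y.2 + _)]exprD.
by rewrite -!scalerA e e'.
Qed.

Lemma loc_addA : associative loc_add.
Proof.
elim/loc_ind=> m a; elim/loc_ind=> m' a'; elim/loc_ind=> m'' a''.
rewrite !loc_addE addnA; congr loc_frac.
rewrite !scalerDr !scalerA -!exprD addrA.
by rewrite [(a'' + a')%N]addnC [(a'' + a)%N]addnC.
Qed.

Lemma loc_addC : commutative loc_add.
Proof.
elim/loc_ind=> m a; elim/loc_ind=> m' a'.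
by rewrite !loc_addE addnC addrC.
Qed.

Lemma loc_add0 : left_id loc_zero loc_add.
Proof.
by elim/loc_ind=> m a; rewrite loc_addE scaler0 add0r expr0 scale1r.
Qed.

Lemma loc_addN : left_inverse loc_zero loc_opp loc_add.
Proof.
elim/loc_ind=> m a; rewrite loc_oppE loc_addE scalerN addNr.
by apply/frac_eqP; exists 0%N; rewrite !scaler0.
Qed.

HB.instance Definition _ :=
  GRing.isZmodule.Build loc loc_addA loc_addC loc_add0 loc_addN.

Lemma loc_scaleA r r' z : loc_scale r (loc_scale r' z) = loc_scale (r * r') z.
Proof. by elim/loc_ind: z => m a; rewrite !loc_scaleE scalerA. Qed.

Lemma loc_scale1 : left_id 1 loc_scale.
Proof. by elim/loc_ind=> m a; rewrite loc_scaleE scale1r. Qed.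

Lemma loc_scaleDr : right_distributive loc_scale +%R.
Proof.
move=> r; elim/loc_ind=> m a; elim/loc_ind=> m' a'.
rewrite [_ + _]loc_addE !loc_scaleE [RHS]loc_addE scalerDr !scalerA.
by rewrite ![r * _]mulrC.
Qed.

Lemma loc_scaleDl z : {morph loc_scale^~ z : r r' / r + r'}.
Proof.
elim/loc_ind: z => m a r r'; rewrite !loc_scaleE [RHS]loc_addE.
apply/frac_eqP; exists 0%N; rewrite !add0n -scalerDr -scalerDl exprD -scalerA.
by [].
Qed.

HB.instance Definition _ := GRing.Zmodule_isLmodule.Build R loc
  loc_scaleA loc_scale1 loc_scaleDr loc_scaleDl.

End Localization.

(* When s' = r * s, the canonical map M_s -> M_s', m/s^a |-> r^a m/s'^a. *)
Definition loc_map (R : comNzRingType) (M : lmodType R) (s s' r : R)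
    (z : loc M s) : loc M s' :=
  loc_frac s' (r ^+ (repr z).2 *: (repr z).1) (repr z).2.

Lemma loc_mapE (R : comNzRingType) (M : lmodType R) (s s' r : R) (m : M) a :
  s' = r * s -> loc_map s' r (loc_frac s m a) = loc_frac s' (r ^+ a *: m) a.
Proof.
move=> ->; have /frac_eqP[u e] := frac_repr (loc_frac s m a).
rewrite /loc_map; set z := repr _ in e *; apply/frac_eqP; exists u.
have eE v w : (r * s) ^+ (u + v) *: (r ^+ w *: m)
            = r ^+ (u + v + w) *: (s ^+ (u + v) *: m).
  by rewrite !scalerA exprMn [r ^+ (u + v + w)]exprD mulrAC.
rewrite eE -e !scalerA exprMn; congr (_ *: _).
by rewrite !exprD; ring.
Qed.

(* Local cohomology of M with support in the ideal (x_1, ..., x_n), as the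
   cohomology of the Cech complex
     0 -> M -> \prod_i M_{x_i} -> \prod_(i < j) M_{x_i x_j} -> ...
   A family c indexed by all subsets S of {1..n} carries cochains of every
   degree at once: its part of degree p is (c S)_(#|S| = p). *)
Section Cech.
Context (R : comNzRingType) (n : nat) (x : 'I_n -> R) (M : lmodType R).

Definition xprod (S : {set 'I_n}) : R := \prod_(i in S) x i.

Definition cochain := forall S : {set 'I_n}, loc M (xprod S).

Definition cech_diff (c : cochain) : cochain := fun T =>
  \sum_(i in T) (-1) ^+ #|[set r in T | (r < i)%N]| *:
    loc_map (xprod T) (x i) (c (T :\ i)).

(* The subcomplex of cochains whose components lie in C has nonzero cohomology
   in degree p. *)
Definition cech_cohomology_neq0 (C : forall S, set (loc M (xprod S)))
    (p : nat) : Prop :=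
  exists c : cochain,
    [/\ forall S : {set 'I_n}, #|S| = p -> C S (c S),
        forall T : {set 'I_n}, #|T| = p.+1 -> cech_diff c T = 0
      & ~ exists b : cochain,
            (forall S : {set 'I_n}, #|S|.+1 = p -> C S (b S)) /\
            (forall S : {set 'I_n}, #|S| = p -> c S = cech_diff b S)].

(* H^p(M) != 0 *)
Definition local_cohomology_neq0 : nat -> Prop :=
  cech_cohomology_neq0 (fun=> setT).

(* For x_1, ..., x_n of degree 1 and M graded, with gr j the piece of degree j:
   the piece of degree j of M_(x_S). *)
Definition loc_piece (gr : int -> set M) (j : int) (S : {set 'I_n}) :
    set (loc M (xprod S)) :=
  [set z | exists m a,
    gr (j + (a * #|S|)%N%:Z) m /\ z = loc_frac (xprod S) m a].

(* H^p(M)_j != 0 *)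
Definition local_cohomology_piece_neq0 (gr : int -> set M) (p : nat) (j : int) :
    Prop :=
  cech_cohomology_neq0 (loc_piece gr j) p.

End Cech.

Section DepthReg.
Context (k : fieldType) (n : nat).
Local Notation R := {mpoly k[n]}.

Definition mvar (i : 'I_n) : R := 'X_i.

(* +oo if M = 0 *)
Definition depth (M : lmodType R) : \bar int :=
  infimum +oo%E [set p%:Z%:E%E | p in [set p | local_cohomology_neq0 mvar M p]].

(* -oo if M = 0; the supremum in \bar int of a nonempty set of integers that is
   bounded above is its maximum. *)
Definition reg (M : lmodType R) (gr : int -> set M) : \bar int :=
  supremum -oo%E [set v : \bar int | exists p j,
    local_cohomology_piece_neq0 mvar gr p j /\ v = (p%:Z + j)%:E%E].

Definition homogeneous_ideal (I : submodClosed R^o) : Prop :=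
  forall (p : R) (d : nat), p \in I -> pihomog mdeg d p \in I.

(* The piece of degree j of R/I. *)
Definition quot_piece (I : submodClosed R^o) (j : int) : set (quotmod I) :=
  [set z | exists2 p : R,
     (if j is Posz d then p \is d.-homog else p == 0) & z = \pi_(quotmod I) p].

End DepthReg.

Arguments quot_piece {k n} I j _.

(* Main.v *)
Require Import Defs.
From HB Require Import structures.
From mathcomp Require Import all_boot all_order all_algebra.
From mathcomp Require Import mpoly.
From mathcomp Require Import boolp classical_sets constructive_ereal.
From mathcomp Require Import zify ring.

(** Write A = R/(J + H), B = R/I, C = R/(J + f R) and N = R/J. As f is a
    non-zerodivisor on N, f r lies in I exactly when r lies in J + H, and in J
    exactly when r does. Multiplication by f therefore gives two short exact
    sequences with the same cokernel,

      0 -> A(-d) -> B -> C -> 0   and   0 -> N(-d) -> N -> C -> 0,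

    and the theorem compares their long exact sequences of local cohomology
    ([les_A], [les_B], [les_C]).

    The sequences alone do not suffice: the connecting map could send the
    cohomology of C isomorphically to that of A and leave no trace in B. This is excluded by
    the projection N -> B, which maps the second sequence to the first one: the
    connecting map H^p(C) -> H^(p+1)(A)(-d) factors through H^(p+1)(B)(-d),
    because N -> A factors through B. So a nonzero H^p(C)_j forces H^p(B)_j or
    H^(p+1)(B)_(j-d) to be nonzero ([connecting_factors]).

    The cohomology of C is controlled by that of N when d > 0. Local cohomology is
    killed elementwise by powers of each variable ([var_torsion]), hence by powers
    of f ([homog_torsion]), so every nonzero class of H^p(N)_j has a multiple by a
    power of f that comes from a class of H^(p-1)(C) of degree at least j + d
    ([cohom_quotient_of_torsion]). With the second sequence this says
    depth C = depth N - 1 and reg C = reg N + d - 1, even if these are infinite.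
    When d = 0, C = 0 and the cohomologies of A and B agree. What remains is
    arithmetic with least and greatest degrees ([least_index_les], [ereal_cut]).

    The depth and the regularity are treated by one argument: ungraded cohomology
    is the graded one for the family of pieces that are all the whole module. *)

Set Implicit Arguments.
Unset Strict Implicit.
Unset Printing Implicit Defensive.

Import GRing.Theory.
Local Open Scope classical_set_scope.
Local Open Scope ring_scope.

(** * Functoriality of localization *)

Section LocalizedMaps.
Context (R : comNzRingType).
Implicit Types (M N : lmodType R) (s r : R).

Lemma loc_fracZ M s r (m : M) a :
  r *: loc_frac s m a = loc_frac s (r *: m) a.
Proof. exact: loc_scaleE. Qed.

Lemma loc_fracMs M s (m : M) a b :
  loc_frac s (s ^+ b *: m) (a + b) = loc_frac s m a.
Proof.
by apply/frac_eqP; exists 0%N; rewrite !add0n scalerA -exprD.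
Qed.

Lemma loc_frac_addE M s (m m' : M) a a' :
  loc_frac s m a + loc_frac s m' a' =
  loc_frac s (s ^+ a' *: m + s ^+ a *: m') (a + a').
Proof. exact: loc_addE. Qed.

Lemma loc_frac0 M s a : loc_frac s (0 : M) a = 0.
Proof. by rewrite -(scale0r (0 : M)) -loc_fracZ scale0r. Qed.

Lemma loc_frac_eq0 M s (m : M) a :
  loc_frac s m a = 0 <-> exists u, s ^+ u *: m = 0.
Proof.
rewrite -(loc_frac0 M s 0); split=> [/frac_eqP[u]|[u e]].
  by rewrite addn0 scaler0; exists u.
by apply/frac_eqP; exists u; rewrite addn0 e scaler0.
Qed.

(** The map induced by [phi] on localizations at [s]; it is only meaningful
    for linear [phi]. *)
Definition loc_fmap M N s (phi : M -> N) (z : loc M s) : loc N s :=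
  loc_frac s (phi (repr z).1) (repr z).2.

Lemma loc_fmapE M N s (phi : {linear M -> N}) (m : M) a :
  loc_fmap phi (loc_frac s m a) = loc_frac s (phi m) a.
Proof.
have /frac_eqP[u e] := frac_repr (loc_frac s m a).
by apply/frac_eqP; exists u; rewrite -!(linearZ_LR phi) e.
Qed.

Lemma loc_fmap_linear M N s (phi : {linear M -> N}) :
  linear (loc_fmap (s := s) phi).
Proof.
move=> r; elim/loc_ind=> m a; elim/loc_ind=> m' a'.
rewrite loc_fracZ loc_frac_addE !loc_fmapE loc_fracZ loc_frac_addE.
by rewrite (linearD phi) !(linearZ_LR phi).
Qed.

Lemma loc_fmap_inj0 M N s (phi : {linear M -> N}) (z : loc M s) :
  (forall m, phi m = 0 -> m = 0) -> loc_fmap phi z = 0 -> z = 0.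
Proof.
move=> inj; elim/loc_ind: z => m a; rewrite loc_fmapE => /loc_frac_eq0[u].
by rewrite -(linearZ_LR phi) => /inj e; apply/loc_frac_eq0; exists u.
Qed.

Lemma loc_map_linear M s s' r :
  s' = r * s -> linear (@loc_map R M s s' r).
Proof.
move=> def_s' c; elim/loc_ind=> m a; elim/loc_ind=> m' a'.
rewrite loc_fracZ loc_frac_addE !loc_mapE // loc_fracZ loc_frac_addE.
congr loc_frac; rewrite scalerDr !scalerA def_s' !exprMn !exprD.
by congr (_ *: _ + _ *: _); ring.
Qed.

Lemma loc_map_fmap M N s s' r (phi : {linear M -> N}) (z : loc M s) :
  s' = r * s -> loc_fmap phi (loc_map s' r z) = loc_map s' r (loc_fmap phi z).
Proof.
move=> def_s'; elim/loc_ind: z => m a.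
by rewrite loc_mapE // !loc_fmapE loc_mapE // (linearZ_LR phi).
Qed.

Lemma loc_map_comp M s s' s'' r r' (z : loc M s) :
  s' = r * s -> s'' = r' * s' ->
  loc_map s'' r' (loc_map s' r z) = loc_map s'' (r' * r) z.
Proof.
move=> e e'; elim/loc_ind: z => m a.
by rewrite !loc_mapE ?e' ?e ?mulrA // scalerA exprMn.
Qed.

(** The kernel of the localization at [r] is the [r]-power torsion. *)
Lemma loc_map_eq0 M s s' r (z : loc M s) :
  s' = r * s -> loc_map s' r z = 0 -> exists u, r ^+ u *: z = 0.
Proof.
move=> def_s'; elim/loc_ind: z => m a; rewrite loc_mapE // => /loc_frac_eq0[u].
rewrite scalerA def_s' exprMn => e; exists (u + a)%N; rewrite loc_fracZ.
by apply/loc_frac_eq0; exists u; rewrite scalerA -e exprD; congr (_ *: _); ring.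
Qed.

End LocalizedMaps.

(** * The Cech complex as a complex of modules *)

Section CechComplex.
Context (R : comNzRingType) (n : nat) (x : 'I_n -> R).
Implicit Types (M N : lmodType R) (S T : {set 'I_n}).

Lemma xprodD1 T i : i \in T -> xprod x T = x i * xprod x (T :\ i).
Proof. by move=> iT; rewrite /xprod (big_setD1 i). Qed.

Lemma xprodU1 T i : i \notin T -> xprod x (i |: T) = x i * xprod x T.
Proof. by move=> iT; rewrite /xprod big_setU1. Qed.

(** Pairing the terms (i, j) and (j, i) with i < j, rather than exchanging the
    two sums, avoids a division by 2. *)
Lemma big_antisym (V : zmodType) T (F : 'I_n -> 'I_n -> V) :
  (forall i j, i \in T -> j \in T -> (i < j)%N -> F i j = - F j i) ->
  \sum_(i in T) \sum_(j in T :\ i) F i j = 0.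
Proof.
move=> antiF.
have split_i i : i \in T -> \sum_(j in T :\ i) F i j =
    \sum_(j in T | (i < j)%N) F i j + \sum_(j in T | (j < i)%N) F i j.
  move=> iT; rewrite (bigID (fun j : 'I_n => (i < j)%N)) /=.
  congr (_ + _); apply: eq_bigl => j; rewrite !inE.
    by case: (eqVneq j i) => [->|//]; rewrite ltnn !andbF.
  by rewrite -leqNgt ltn_neqAle -val_eqE /= andbCA andbA.
rewrite (eq_bigr _ split_i) big_split /=.
rewrite [X in _ + X](exchange_big_dep (mem T)) //=; last first.
  by move=> i j _ /andP[].
rewrite -big_split big1 //= => i iT.
rewrite iT /= -big_split big1 //= => j /andP[jT ij].
by rewrite antiF // addNr.
Qed.

Section CochainModule.
Context (M : lmodType R).
Local Notation K := (cochain x M).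

HB.instance Definition _ := gen_eqMixin K.
HB.instance Definition _ := gen_choiceMixin K.

Definition cochain_zero : K := fun=> 0.
Definition cochain_opp (c : K) : K := fun S => - c S.
Definition cochain_add (c c' : K) : K := fun S => c S + c' S.
Definition cochain_scale (r : R) (c : K) : K := fun S => r *: c S.

Lemma cochainP (c c' : K) : (forall S, c S = c' S) -> c = c'.
Proof. exact: functional_extensionality_dep. Qed.

Lemma cochain_addA : associative cochain_add.
Proof. by move=> *; apply/cochainP => S; exact: addrA. Qed.
Lemma cochain_addC : commutative cochain_add.
Proof. by move=> *; apply/cochainP => S; exact: addrC. Qed.
Lemma cochain_add0 : left_id cochain_zero cochain_add.
Proof. by move=> *; apply/cochainP => S; exact: add0r. Qed.
Lemma cochain_addN : left_inverse cochain_zero cochain_opp cochain_add.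
Proof. by move=> *; apply/cochainP => S; exact: addNr. Qed.

HB.instance Definition _ := GRing.isZmodule.Build K
  cochain_addA cochain_addC cochain_add0 cochain_addN.

Lemma cochain_scaleA r r' c :
  cochain_scale r (cochain_scale r' c) = cochain_scale (r * r') c.
Proof. by apply/cochainP => S; exact: scalerA. Qed.
Lemma cochain_scale1 : left_id 1 cochain_scale.
Proof. by move=> c; apply/cochainP => S; exact: scale1r. Qed.
Lemma cochain_scaleDr : right_distributive cochain_scale +%R.
Proof. by move=> *; apply/cochainP => S; exact: scalerDr. Qed.
Lemma cochain_scaleDl c : {morph cochain_scale^~ c : r r' / r + r'}.
Proof. by move=> *; apply/cochainP => S; exact: scalerDl. Qed.

HB.instance Definition _ := GRing.Zmodule_isLmodule.Build R K
  cochain_scaleA cochain_scale1 cochain_scaleDr cochain_scaleDl.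

Lemma cochainD (c c' : K) S : (c + c') S = c S + c' S. Proof. by []. Qed.
Lemma cochainN (c : K) S : (- c) S = - c S. Proof. by []. Qed.
Lemma cochainZ r (c : K) S : (r *: c) S = r *: c S. Proof. by []. Qed.
Lemma cochain0 S : (0 : K) S = 0. Proof. by []. Qed.

Lemma cech_diff_linear : linear (@cech_diff R n x M).
Proof.
move=> r c c'; apply/cochainP => T.
rewrite cochainD cochainZ /cech_diff scaler_sumr -big_split /=.
apply: eq_bigr => i iT.
rewrite cochainD cochainZ (loc_map_linear (xprodD1 iT)) scalerDr !scalerA.
by rewrite mulrC.
Qed.

HB.instance Definition _ := GRing.isLinear.Build R K K _ (@cech_diff R n x M)
  cech_diff_linear.

Lemma cech_diff0 : cech_diff (0 : K) = 0. Proof. exact: linear0. Qed.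
Lemma cech_diffD (c c' : K) : cech_diff (c + c') = cech_diff c + cech_diff c'.
Proof. exact: linearD. Qed.
Lemma cech_diffB (c c' : K) : cech_diff (c - c') = cech_diff c - cech_diff c'.
Proof. exact: linearB. Qed.
Lemma cech_diffZ r (c : K) : cech_diff (r *: c) = r *: cech_diff c.
Proof. exact: linearZ_LR. Qed.

(** The restriction of [c S] to the localization at [xprod x T], for S in T.
    Writing it as a function of the set [S] alone lets the two orders of
    removing i and j from T be compared by rewriting sets, although the
    components of [c] live in different types. *)
Definition transport (c : K) T S : loc M (xprod x T) :=
  loc_map (xprod x T) (xprod x (T :\: S)) (c S).

Lemma transport2 (c : K) T i j : i \in T -> j \in T :\ i ->
  loc_map (xprod x T) (x i)
    (loc_map (xprod x (T :\ i)) (x j) (c (T :\ i :\ j))) =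
  transport c T (T :\: [set i; j]).
Proof.
move=> iT jT; rewrite (loc_map_comp _ (xprodD1 jT) (xprodD1 iT)).
rewrite /transport finset.setDDr finset.setDv finset.set0U finset.setIC
  (finset.setIidPl _); last first.
  by move: jT; rewrite finset.subUset !finset.sub1set iT inE => /andP[].
have -> : xprod x [set i; j] = x i * x j.
  rewrite /xprod big_setU1 ?big_set1 // inE eq_sym.
  by move: jT; rewrite !inE => /andP[].
by rewrite finset.setDDl.
Qed.

(** Removing i then j, or j then i, gives the same restriction; the two signs
    are opposite because the larger index loses one predecessor when the
    smaller one is removed first. *)
Lemma cech_diffK (c : K) : cech_diff (cech_diff c) = 0.
Proof.
apply/cochainP => T; rewrite cochain0.
pose pos (U : {set 'I_n}) (i : 'I_n) := #|[set r in U | (r < i)%N]|.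
pose F i j := (-1) ^+ (pos T i + pos (T :\ i) j) *:
  transport c T (T :\: [set i; j]).
transitivity (\sum_(i in T) \sum_(j in T :\ i) F i j).
  apply: eq_bigr => i iT.
  pose L := HB.pack_for {linear _ -> _} (@loc_map R M _ (xprod x T) (x i))
    (GRing.isLinear.Build R _ _ _ _ (loc_map_linear (M := M) (xprodD1 iT))).
  rewrite -[loc_map _ _]/(L : _ -> _) linear_sum scaler_sumr.
  apply: eq_bigr => j jT; rewrite linearZ /= transport2 // scalerA.
  by rewrite -exprD.
apply: big_antisym => i j iT jT ij; rewrite /F finset.setUC.
have -> : pos T j = (pos (T :\ i) j).+1.
  rewrite /pos (cardsD1 i) !inE iT ij add1n; congr _.+1.
  by apply: eq_card => r; rewrite !inE andbA.
have -> : pos (T :\ j) i = pos T i.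
  apply: eq_card => r; rewrite !inE; case: eqP => // ->.
  by rewrite [(j < i)%N]ltnNge (ltnW ij) !andbF.
by rewrite addSn exprS mulN1r scaleNr opprK addnC.
Qed.

End CochainModule.

Definition cochain_map M N (phi : M -> N) (c : cochain x M) : cochain x N :=
  fun S => loc_fmap phi (c S).

Lemma cochain_map_linear M N (phi : {linear M -> N}) :
  linear (cochain_map phi).
Proof.
move=> r c c'; apply/cochainP => S.
exact: (loc_fmap_linear (s := xprod x S) phi).
Qed.

HB.instance Definition _ M N (phi : {linear M -> N}) :=
  GRing.isLinear.Build R (cochain x M) (cochain x N) _ (cochain_map phi)
    (cochain_map_linear phi).

Lemma cochain_mapB M N (phi : {linear M -> N}) (c c' : cochain x M) :
  cochain_map phi (c - c') = cochain_map phi c - cochain_map phi c'.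
Proof. exact: linearB. Qed.
Lemma cochain_mapZ M N (phi : {linear M -> N}) r (c : cochain x M) :
  cochain_map phi (r *: c) = r *: cochain_map phi c.
Proof. exact: linearZ_LR. Qed.

Lemma cech_diff_map M N (phi : {linear M -> N}) (c : cochain x M) :
  cech_diff (cochain_map phi c) = cochain_map phi (cech_diff c).
Proof.
apply/cochainP => T.
pose L := HB.pack_for {linear _ -> _} (@loc_fmap R M N (xprod x T) phi)
  (GRing.isLinear.Build R _ _ _ _ (loc_fmap_linear (s := xprod x T) phi)).
rewrite /cochain_map /= -[loc_fmap _]/(L : _ -> _) linear_sum.
apply: eq_bigr => i iT; rewrite linearZ /=; congr (_ *: _).
by rewrite (loc_map_fmap _ _ (xprodD1 iT)).
Qed.

Lemma cochain_map_comp M N (P : lmodType R) (phi : {linear M -> N})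
    (psi : {linear N -> P})
    (chi : {linear M -> P}) (c : cochain x M) :
  (forall m, psi (phi m) = chi m) ->
  cochain_map psi (cochain_map phi c) = cochain_map chi c.
Proof.
move=> e; apply/cochainP => S; rewrite /cochain_map.
by elim/loc_ind: (c S) => m a; rewrite !loc_fmapE e.
Qed.

Lemma cochain_map_scale M (phi : {linear M -> M}) r (c : cochain x M) :
  (forall m, phi m = r *: m) -> cochain_map phi c = r *: c.
Proof.
move=> e; apply/cochainP => S; rewrite /cochain_map cochainZ.
by elim/loc_ind: (c S) => m a; rewrite !loc_fmapE e loc_fracZ.
Qed.

Lemma cochain_map_inj0 M N (phi : {linear M -> N}) (c : cochain x M) :
  (forall m, phi m = 0 -> m = 0) -> cochain_map phi c = 0 -> c = 0.
Proof.
move=> inj e; apply/cochainP => S; apply: (loc_fmap_inj0 inj).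
by rewrite -[LHS]/(cochain_map phi c S) e.
Qed.

End CechComplex.

(** * Graded Cech cohomology *)

(** Finitely many denominators can be cleared by one common exponent. *)
Lemma eventually_finite (T : finType) (P : T -> nat -> Prop) :
  (forall t, exists L0, forall L, (L0 <= L)%N -> P t L) ->
  exists L, forall t, P t L.
Proof.
move=> /choice[L0 hL0]; exists (\max_t L0 t) => t.
exact/hL0/leq_bigmax.
Qed.

Definition maps_degree (M N : Type) (gr : int -> set M) (gr' : int -> set N)
    (e : int) (phi : M -> N) :=
  forall j m, gr j m -> gr' (j + e) (phi m).

Section GradedCech.
Context (R : comNzRingType) (n : nat) (x : 'I_n -> R).
Implicit Types (S T : {set 'I_n}) (p j e : int).

(** The constant family [fun=> setT] is a grading in this weak sense; through it
    ungraded cohomology is a special case of graded cohomology. *)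
Record grading (M : lmodType R) (gr : int -> set M) : Prop := Grading {
  gr_0 : forall j, gr j 0;
  gr_B : forall j m m', gr j m -> gr j m' -> gr j (m - m');
  gr_X : forall i, maps_degree gr gr 1 (fun m => x i *: m)
}.

(** Chains vanish outside cardinality [p], so that boundaries and cocycles are
    equations in one module, [cochain]. The index [p] is an integer: for negative
    [p] the group is zero, which makes the exact sequences uniform at the left
    end. *)
Definition chains (M : lmodType R) (gr : int -> set M) p j :
    set (cochain x M) :=
  [set c | forall S, if #|S|%:Z == p then loc_piece gr j (c S) else c S = 0].

Definition cobound (M : lmodType R) (gr : int -> set M) p j
    (c : cochain x M) : Prop :=
  exists2 b, chains gr (p - 1) j b & c = cech_diff b.

Definition cohom_neq0 (M : lmodType R) (gr : int -> set M) p j : Prop :=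
  exists c, [/\ chains gr p j c, cech_diff c = 0 & ~ cobound gr p j c].

Section OneModule.
Context (M : lmodType R) (gr : int -> set M).

Lemma gr_xprod (hgr : grading gr) S b j m :
  gr j m -> gr (j + (b * #|S|)%N%:Z) (xprod x S ^+ b *: m).
Proof.
have grX1 (U : {set 'I_n}) : forall j m, gr j m -> gr (j + #|U|%:Z) (xprod x U *: m).
  rewrite /xprod -sum1_card; elim/big_rec2: _ => [j' m'|i l r iU IH j' m' gm].
    by rewrite addr0 scale1r.
  rewrite -scalerA PoszD [1%N%:Z + _]addrC addrA.
  exact/(gr_X hgr)/IH.
elim: b j m => [|b IH] j m gm; first by rewrite mul0n addr0 expr0 scale1r.
rewrite exprS -scalerA mulSn addnC PoszD addrA.
exact/grX1/IH.
Qed.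

Lemma gr_Xn (hgr : grading gr) i b : maps_degree gr gr b%:Z ( *:%R (x i ^+ b)).
Proof.
elim: b => [|b IH] j m gm; first by rewrite addr0 expr0 scale1r.
rewrite exprS -scalerA -addn1 PoszD addrA.
exact/(gr_X hgr)/IH.
Qed.

Lemma loc_piece0 (hgr : grading gr) j S : loc_piece gr j (0 : loc M (xprod x S)).
Proof. by exists 0, 0%N; split; [exact: gr_0|rewrite loc_frac0]. Qed.

Lemma loc_pieceB (hgr : grading gr) j S (y z : loc M (xprod x S)) :
  loc_piece gr j y -> loc_piece gr j z -> loc_piece gr j (y - z).
Proof.
move=> [m [a [gm ->]]] [m' [a' [gm' ->]]].
exists (xprod x S ^+ a' *: m - xprod x S ^+ a *: m'), (a + a')%N; split.
  apply: (gr_B hgr).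
    by rewrite mulnDl PoszD addrA; exact: gr_xprod.
  by rewrite addnC mulnDl PoszD addrA; exact: gr_xprod.
by rewrite -[- loc_frac _ _ _]scaleN1r loc_fracZ scaleN1r loc_frac_addE scalerN.
Qed.

Lemma loc_pieceZ e (r : R) j S (z : loc M (xprod x S)) :
  maps_degree gr gr e ( *:%R r) ->
  loc_piece gr j z -> loc_piece gr (j + e) (r *: z).
Proof.
move=> re [m [a [gm ->]]]; exists (r *: m), a; split; last exact: loc_fracZ.
by rewrite addrAC; exact: re.
Qed.

Lemma loc_piece_map (hgr : grading gr) j T i (z : loc M (xprod x (T :\ i))) :
  i \in T -> loc_piece gr j z -> loc_piece gr j (loc_map (xprod x T) (x i) z).
Proof.
move=> iT [m [a [gm ->]]]; exists (x i ^+ a *: m), a; split.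
  by rewrite (cardsD1 i T) iT add1n mulnS addnC PoszD addrA; exact: gr_Xn.
by rewrite loc_mapE // -xprodD1.
Qed.

Lemma chains0 (hgr : grading gr) p j : chains gr p j 0.
Proof. by move=> S; rewrite cochain0; case: eqP => // _; exact: loc_piece0. Qed.

Lemma chainsB (hgr : grading gr) p j b c :
  chains gr p j b -> chains gr p j c -> chains gr p j (b - c).
Proof.
move=> hb hc S; move: (hb S) (hc S); rewrite cochainD cochainN.
by case: eqP => _; [exact: loc_pieceB|move=> -> ->; rewrite subr0].
Qed.

Lemma chainsN (hgr : grading gr) p j c : chains gr p j c -> chains gr p j (- c).
Proof. by rewrite -sub0r => hc; apply: chainsB => //; exact: chains0. Qed.

Lemma chainsD (hgr : grading gr) p j b c :
  chains gr p j b -> chains gr p j c -> chains gr p j (b + c).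
Proof. by move=> hb hc; rewrite -[c]opprK; apply/chainsB/chainsN. Qed.

Lemma chainsZ e (r : R) p j c :
  maps_degree gr gr e ( *:%R r) ->
  chains gr p j c -> chains gr p (j + e) (r *: c).
Proof.
move=> re hc S; move: (hc S); rewrite cochainZ; case: eqP => _.
  exact: loc_pieceZ.
by move=> ->; rewrite scaler0.
Qed.

Lemma loc_map0 T i : i \in T ->
  loc_map (xprod x T) (x i) (0 : loc M (xprod x (T :\ i))) = 0.
Proof.
by move=> iT; rewrite -(loc_frac0 M _ 0) loc_mapE -?xprodD1 // scaler0 loc_frac0.
Qed.

Lemma loc_piece_sum (hgr : grading gr) j S (I : eqType) (r : seq I) (P : pred I)
    (F : I -> loc M (xprod x S)) :
  (forall i, P i -> loc_piece gr j (F i)) ->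
  loc_piece gr j (\sum_(i <- r | P i) F i).
Proof.
move=> hF; elim/big_rec: _ => [|i z Pi hz]; first exact: loc_piece0.
rewrite -[z]opprK; apply: loc_pieceB => //; first exact: hF.
by rewrite -sub0r; apply: loc_pieceB => //; exact: loc_piece0.
Qed.

Lemma chains_diff (hgr : grading gr) p j c :
  chains gr p j c -> chains gr (p + 1) j (cech_diff c).
Proof.
move=> hc T; case: eqP => [cardT|ncardT]; last first.
  rewrite /cech_diff big1 // => i iT; have := hc (T :\ i).
  case: eqP => [cardTi|_ ->]; last by rewrite loc_map0 // scaler0.
  by case: ncardT; rewrite -cardTi (cardsD1 i) iT addnC PoszD.
apply: loc_piece_sum => // i iT; rewrite -[j]addr0; apply: loc_pieceZ.
  move=> j' m gm; rewrite addr0 -signr_odd; case: odd.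
    by rewrite scaleN1r -sub0r; apply: (gr_B hgr) => //; exact: (gr_0 hgr).
  by rewrite scale1r.
apply: loc_piece_map => //; have := hc (T :\ i); case: eqP => // ncard.
by case: ncard; move: cardT; rewrite (cardsD1 i) iT; lia.
Qed.

(** Surjectivity and exactness hold for each localization; this glues the choices
    made on the components into a chain. *)
Lemma chains_choice p j (Q : forall S, loc M (xprod x S) -> Prop) :
  (forall S, #|S|%:Z = p -> exists2 z, loc_piece gr j z & Q S z) ->
  exists2 c, chains gr p j c & forall S, #|S|%:Z = p -> Q S (c S).
Proof.
move=> hQ.
have hS S : {z : loc M (xprod x S) |
    if #|S|%:Z == p then loc_piece gr j z /\ Q S z else z = 0}.
  apply: cid; case: eqP => [/hQ[z]|_]; last by exists 0.
  by exists z.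
exists (fun S => sval (hS S)) => [S|S cS]; case: (hS S) => /= z.
  by case: eqP => // _ [].
by rewrite cS eqxx => -[].
Qed.

Lemma coboundZ e (r : R) p j c :
  maps_degree gr gr e ( *:%R r) ->
  cobound gr p j c -> cobound gr p (j + e) (r *: c).
Proof.
move=> re [b hb ->]; exists (r *: b); first exact: chainsZ.
by rewrite cech_diffZ.
Qed.

Lemma coboundD (hgr : grading gr) p j b c :
  cobound gr p j b -> cobound gr p j c -> cobound gr p j (b + c).
Proof.
move=> [b' hb' ->] [c' hc' ->]; exists (b' + c'); first exact: chainsD.
by rewrite cech_diffD.
Qed.

Lemma cobound0 (hgr : grading gr) p j : cobound gr p j 0.
Proof. by exists 0; [exact: chains0|rewrite cech_diff0]. Qed.

Lemma cohom_neq0_ge0 p j : cohom_neq0 gr p j -> (0 <= p)%R.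
Proof.
case: p => // p [c [hc _ []]]; have c0 : c = 0.
  by apply/cochainP => S; exact: (hc S).
exists 0; last by rewrite c0 cech_diff0.
by move=> S; exact: cochain0.
Qed.

(** Both sides only see the components of cardinality [p] and [p - 1], so
    truncating a cochain to one cardinality passes from one to the other. *)
Lemma cohom_neq0P (C : forall S, set (loc M (xprod x S))) (p : nat) j :
  (forall S, C S = loc_piece gr j (S := S)) ->
  cech_cohomology_neq0 C p <-> cohom_neq0 gr p j.
Proof.
move=> hC; pose trunc (q : int) (c : cochain x M) : cochain x M :=
  fun S => if #|S|%:Z == q then c S else 0.
have truncP q c : (forall S, #|S|%:Z = q -> C S (c S)) -> chains gr q j (trunc q c).
  by move=> hc S; rewrite /trunc; case: eqP => // /hc; rewrite hC.
have trunc_diff q c T : cech_diff (trunc q c) T =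
    if #|T|%:Z == q + 1 then cech_diff c T else 0.
  case: ifP => [cT|ncT]; first apply: eq_bigr => i iT; last first.
    apply: big1 => i iT; rewrite /trunc ifF ?loc_map0 ?scaler0 //.
    by apply: contraFF ncT => /eqP <-; rewrite (cardsD1 i) iT addnC PoszD.
  rewrite /trunc ifT //; move: cT; rewrite (cardsD1 i T) iT addnC PoszD.
  by move/eqP/addIr ->.
split=> [[c [hc dc nc]]|[c [hc dc nc]]].
  exists (trunc p c); split.
  - by apply: truncP => S [/hc].
  - apply/cochainP => T; rewrite trunc_diff; case: eqP => // cT.
    by rewrite dc //; lia.
  case=> b hb eb; apply: nc; exists b; split=> S cS.
    rewrite hC; have := hb S; case: eqP => // ncS.
    by case: ncS; lia.
  by rewrite -eb /trunc cS eqxx.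
exists c; split.
- by move=> S cS; rewrite hC; have := hc S; rewrite cS eqxx.
- by move=> T _; rewrite dc.
case=> b [hb eb]; apply: nc; exists (trunc (p%:Z - 1) b).
  by apply: truncP => S cS; apply: hb; lia.
apply/cochainP => S; rewrite trunc_diff subrK.
by have := hc S; case: eqP => // -[cS] _; rewrite eb.
Qed.

End OneModule.

Lemma chains_map (M N : lmodType R) (gr : int -> set M) (gr' : int -> set N) e
    (phi : {linear M -> N}) p j c :
  maps_degree gr gr' e phi ->
  chains gr p j c -> chains gr' p (j + e) (cochain_map phi c).
Proof.
move=> hphi hc S; have := hc S; rewrite /cochain_map; case: eqP => _.
  move=> [m [a [gm ->]]]; rewrite loc_fmapE; exists (phi m), a; split=> //.
  by rewrite addrAC; exact: hphi.
by move=> ->; rewrite -(loc_frac0 M _ 0) loc_fmapE linear0 loc_frac0.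
Qed.

Section Torsion.
Context (M : lmodType R) (gr : int -> set M) (hgr : grading gr).

(** A fraction over x_S x_i becomes a fraction over x_S once x_i ^+ a clears
    the x_i-part of its denominator. *)
Lemma local_lift (c : cochain x M) p j i S (s : bool) :
  chains gr p j c -> i \notin S -> #|S|%:Z = p - 1 ->
  exists L0, forall L, (L0 <= L)%N -> exists2 z : loc M (xprod x S),
    loc_piece gr (j + L%:Z) z &
    loc_map (xprod x (i |: S)) (x i) z = (-1) ^+ s *: (x i ^+ L *: c (i |: S)).
Proof.
move=> hc iS cS; have := hc (i |: S).
rewrite ifT; last by rewrite cardsU1 iS; lia.
move=> [m [a []]]; rewrite cardsU1 iS => gm ->; exists a => L aL.
exists (loc_frac (xprod x S) ((-1) ^+ s *: (x i ^+ (L - a) *: m)) a).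
  rewrite -[j + _]addr0 -loc_fracZ; apply: loc_pieceZ.
    move=> j' m' gm'; rewrite addr0; case: s; last by rewrite scale1r.
    by rewrite scaleN1r -sub0r; apply: (gr_B hgr) => //; exact: (gr_0 hgr).
  exists (x i ^+ (L - a) *: m), a; split=> //.
  have -> : j + L%:Z + (a * #|S|)%N%:Z =
            j + (a * (true + #|S|))%N%:Z + (L - a)%N%:Z by lia.
  exact: gr_Xn.
rewrite loc_mapE ?xprodU1 // !loc_fracZ !scalerA; congr loc_frac.
by rewrite [x i ^+ a * _]mulrC -mulrA -exprD subnKC.
Qed.

(** All the terms of the sum but the one removing i keep i in their index. *)
Lemma diff_single (c : cochain x M) i S : i \notin S ->
  (forall T, i \in T -> c T = 0) ->
  cech_diff c (i |: S) =
  (-1) ^+ #|[set r in (i |: S) | (r < i)%N]| *: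
     loc_map (xprod x (i |: S)) (x i) (c S).
Proof.
move=> iS c0; rewrite /cech_diff (big_setD1 i) ?finset.setU11 //= big1 ?addr0.
  by rewrite finset.setU1K.
move=> i'; rewrite !inE => /andP[ii' /orP[/eqP e|i'S]].
  by rewrite e eqxx in ii'.
rewrite c0 ?loc_map0 ?scaler0 // !inE ?i'S ?orbT // eqxx andbT.
by rewrite eq_sym.
Qed.

(** The localization of the Cech complex at x_i is contractible, through the
    homotopy that sends c to S |-> +- c_(S + i). After multiplication by a high
    power of x_i this homotopy lands in the complex itself and gives b. The
    cocycle z := x_i ^+ L c - d b vanishes on the sets containing i by the choice
    of b; the cocycle condition at i |: T then says that z T dies in the
    localization at x_i, so a further power of x_i kills z. *)
Lemma var_torsion p j c i :
  chains gr p j c -> cech_diff c = 0 ->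
  exists L : nat, cobound gr p (j + L%:Z) (x i ^+ L *: c).
Proof.
move=> hc dc.
(* the sign of i in the sum over i |: S, which the homotopy has to undo *)
pose eps S := odd #|[set r in (i |: S) | (r < i)%N]|.
have [L hL] : exists L, forall S, #|S|%:Z = p - 1 -> i \notin S ->
    exists2 z : loc M (xprod x S), loc_piece gr (j + L%:Z) z &
    loc_map (xprod x (i |: S)) (x i) z =
      (-1) ^+ eps S *: (x i ^+ L *: c (i |: S)).
  apply: (eventually_finite (P := fun S L => _)) => S.
  case: (boolP (i \in S)) => [iS|iS]; first by exists 0%N.
  case: (pselect (#|S|%:Z = p - 1)) => cS; last by exists 0%N.
  have [L0 hL0] := local_lift (eps S) hc iS cS.
  by exists L0 => L /hL0 h _ _.
pose Q S (z : loc M (xprod x S)) := if i \in S then z = 0 else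
  loc_map (xprod x (i |: S)) (x i) z =
      (-1) ^+ eps S *: (x i ^+ L *: c (i |: S)).
have [b hb bQ] : exists2 b, chains gr (p - 1) (j + L%:Z) b &
    forall S, #|S|%:Z = p - 1 -> Q S (b S).
  apply: chains_choice => S cS; rewrite /Q; case: (boolP (i \in S)) => iS.
    by exists 0 => //; exact: loc_piece0.
  exact: hL.
have b0 T : i \in T -> b T = 0.
  move=> iT; have := hb T; case: eqP => // /bQ.
  by rewrite /Q iT.
pose z := x i ^+ L *: c - cech_diff b.
have hz : chains gr p (j + L%:Z) z.
  apply: chainsB => //; first by apply: chainsZ => //; exact: gr_Xn.
  by rewrite -[p](subrK 1); exact: chains_diff.
have dz : cech_diff z = 0 by rewrite cech_diffB cech_diffZ dc cech_diffK scaler0 subr0.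
have z0 T : i \in T -> z T = 0.
  move=> iT; have := hz T; case: eqP => // cT _.
  have iTi : i \notin T :\ i by rewrite !inE eqxx.
  rewrite -(finset.setD1K iT) in cT *; move: (T :\ i) iTi cT => S iS cT {T iT}.
  have := bQ S; rewrite /Q (negbTE iS) => bS.
  rewrite /z cochainD cochainN cochainZ diff_single // bS; last first.
    by move: cT; rewrite cardsU1 iS; lia.
  by rewrite /eps signr_odd signrZK subrr.
have [u hu] : exists u, forall T, x i ^+ u *: z T = 0.
  apply: (eventually_finite (P := fun T u => _)) => T.
  case: (boolP (i \in T)) => iT.
    by exists 0%N => u _; rewrite z0 // scaler0.
  have := diff_single iT z0; rewrite dz cochain0; set k := #|_|.
  move=> /esym/(congr1 ( *:%R ((-1) ^+ k))).
  rewrite signrZK scaler0 => /(loc_map_eq0 (xprodU1 x iT))[u0 e].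
  by exists u0 => u /subnK <-; rewrite exprD -scalerA e scaler0.
exists (L + u)%N; exists (x i ^+ u *: b).
  by rewrite PoszD addrA; apply: chainsZ => //; exact: gr_Xn.
rewrite cech_diffZ; apply/eqP; rewrite addnC exprD -scalerA -subr_eq0 -scalerBr.
by apply/eqP/cochainP => T; exact: hu.
Qed.

End Torsion.

End GradedCech.

(** * Long exact sequences of Cech cohomology *)

Section ExactSequences.
Context (R : comNzRingType) (n : nat) (x : 'I_n -> R).
Implicit Types (p j e : int).

(** Exactness of 0 -> A(-e) -> B -> C -> 0, degree by degree where the grading
    enters; this is the form that passes to localizations. *)
Record short_exact (A B C : lmodType R) (grA : int -> set A)
    (grB : int -> set B) (grC : int -> set C) e
    (u : {linear A -> B}) (v : {linear B -> C}) : Prop := ShortExact {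
  se_u : maps_degree grA grB e u;
  se_v : maps_degree grB grC 0 v;
  se_inj : forall a, u a = 0 -> a = 0;
  se_vu : forall a, v (u a) = 0;
  se_ex : forall j b, grB (j + e) b -> v b = 0 -> exists2 a, grA j a & u a = b;
  se_surj : forall j c, grC j c -> exists2 b, grB j b & v b = c
}.

Section LongExact.
Context (A B C : lmodType R).
Context (grA : int -> set A) (grB : int -> set B) (grC : int -> set C) (e : int).
Context (u : {linear A -> B}) (v : {linear B -> C}).
Hypothesis hB : grading x grB.
Hypothesis se : short_exact grA grB grC e u v.

(** A component of b is killed by v only after multiplication by a power of
    x_S; this power is absorbed in the denominator of the lift. *)
Lemma chains_exact p j (b : cochain x B) :
  chains grB p (j + e) b -> cochain_map v b = 0 ->
  exists2 a, chains grA p j a & cochain_map u a = b.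
Proof.
move=> hb vb0.
pose Q (S : {set 'I_n}) (z : loc A (xprod x S)) := loc_fmap u z = b S.
have [a ha aQ] : exists2 a, chains grA p j a &
    forall S : {set 'I_n}, #|S|%:Z = p -> Q S (a S).
  apply: chains_choice => S cS; have := hb S; rewrite cS eqxx => -[m [t [gm e_b]]].
  have : cochain_map v b S = 0 by rewrite vb0.
  rewrite /cochain_map e_b loc_fmapE => /loc_frac_eq0[w].
  rewrite -(linearZ_LR v) => vw.
  have [|a ga ua] := se_ex se (j := j + ((t + w) * #|S|)%N%:Z) _ vw.
    have -> : j + ((t + w) * #|S|)%N%:Z + e =
      j + e + (t * #|S|)%N%:Z + (w * #|S|)%N%:Z by lia.
    exact: gr_xprod.
  exists (loc_frac (xprod x S) a (t + w)).
    by exists a, (t + w)%N.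
  by rewrite /Q loc_fmapE ua loc_fracMs e_b.
exists a => //; apply/cochainP => S; rewrite /cochain_map.
have [cS|ncS] := eqVneq #|S|%:Z p; first exact: aQ.
have := ha S; have := hb S; rewrite (negbTE ncS) => -> ->.
by rewrite -(loc_frac0 A _ 0) loc_fmapE linear0 loc_frac0.
Qed.

Lemma chains_surj p j (c : cochain x C) :
  chains grC p j c -> exists2 b, chains grB p j b & cochain_map v b = c.
Proof.
move=> hc.
pose Q (S : {set 'I_n}) (z : loc B (xprod x S)) := loc_fmap v z = c S.
have [b hb bQ] : exists2 b, chains grB p j b &
    forall S : {set 'I_n}, #|S|%:Z = p -> Q S (b S).
  apply: chains_choice => S cS; have := hc S; rewrite cS eqxx => -[m [t [gm ec]]].
  have [b gb vb] := se_surj se gm.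
  exists (loc_frac (xprod x S) b t); first by exists b, t.
  by rewrite /Q loc_fmapE vb ec.
exists b => //; apply/cochainP => S; rewrite /cochain_map.
have [cS|ncS] := eqVneq #|S|%:Z p; first exact: bQ.
have := hb S; have := hc S; rewrite (negbTE ncS) => -> ->.
by rewrite -(loc_frac0 B _ 0) loc_fmapE linear0 loc_frac0.
Qed.

Lemma chains_v p j (b : cochain x B) :
  chains grB p j b -> chains grC p j (cochain_map v b).
Proof. by rewrite -{2}[j]addr0; apply: chains_map; exact: (se_v se). Qed.

Lemma cochain_vu (a : cochain x A) : cochain_map v (cochain_map u a) = 0.
Proof.
rewrite (@cochain_map_comp _ _ _ _ _ _ u v \0) ?(se_vu se) //; last exact: (se_vu se).
by apply/cochainP => S; rewrite /cochain_map /loc_fmap loc_frac0.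
Qed.

(** If u a = d b, then v b is a cocycle whose image under the connecting map is
    the class of a. *)
Lemma les_connecting p j (a : cochain x A) :
  chains grA p j a -> cech_diff a = 0 -> ~ cobound grA p j a ->
  cobound grB p (j + e) (cochain_map u a) -> cohom_neq0 x grC (p - 1) (j + e).
Proof.
move=> ha da na [b hb ub]; exists (cochain_map v b); split.
- exact: chains_v.
- by rewrite cech_diff_map -ub cochain_vu.
case=> c /chains_surj[b' hb' <-]; rewrite cech_diff_map => eb.
have db' : chains grB (p - 1) (j + e) (cech_diff b').
  by rewrite -[p - 1](subrK 1); exact: chains_diff.
have [a' ha' ua'] : exists2 a', chains grA (p - 1) j a' &
    cochain_map u a' = b - cech_diff b'.
  apply: chains_exact; first exact: chainsB.
  by rewrite cochain_mapB eb subrr.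
apply: na; exists a' => //; apply/eqP; rewrite -subr_eq0.
apply/eqP/(cochain_map_inj0 (se_inj se)).
by rewrite cochain_mapB -[cochain_map u (cech_diff a')]cech_diff_map ua'
  cech_diffB cech_diffK subr0 ub subrr.
Qed.

Lemma les_A p j : cohom_neq0 x grA p j ->
  cohom_neq0 x grB p (j + e) \/ cohom_neq0 x grC (p - 1) (j + e).
Proof.
move=> [a [ha da na]].
case: (pselect (cobound grB p (j + e) (cochain_map u a))) => hb.
  by right; exact: les_connecting hb.
left; exists (cochain_map u a); split=> //.
  exact: chains_map (se_u se) ha.
by rewrite cech_diff_map da; apply: (linear0 (cochain_map u)).
Qed.

Lemma les_B p j : cohom_neq0 x grB p (j + e) ->
  cohom_neq0 x grA p j \/ cohom_neq0 x grC p (j + e).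
Proof.
move=> [b [hb db nb]].
case: (pselect (cobound grC p (j + e) (cochain_map v b))); last first.
  move=> nc; right; exists (cochain_map v b); split=> //; first exact: chains_v.
  by rewrite cech_diff_map db; apply: (linear0 (cochain_map v)).
move=> [c /chains_surj[b' hb' <-]]; rewrite cech_diff_map => eb.
have db' : chains grB p (j + e) (cech_diff b').
  by rewrite -[p](subrK 1); exact: chains_diff.
have [a ha ua] : exists2 a, chains grA p j a & cochain_map u a = b - cech_diff b'.
  apply: chains_exact; first exact: chainsB.
  by rewrite cochain_mapB eb subrr.
left; exists a; split=> // [|[a' ha' def_a]].
  apply: (cochain_map_inj0 (se_inj se)).
  by rewrite -cech_diff_map ua cech_diffB db cech_diffK subr0.
apply: nb; exists (b' + cochain_map u a').
  by apply: chainsD => //; exact: chains_map (se_u se) ha'.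
by rewrite cech_diffD cech_diff_map -def_a ua addrC subrK.
Qed.

Lemma les_C p j : cohom_neq0 x grC p (j + e) ->
  cohom_neq0 x grB p (j + e) \/ cohom_neq0 x grA (p + 1) j.
Proof.
move=> [c [/chains_surj[b hb <-] dc nc]].
have [a ha ua] : exists2 a, chains grA (p + 1) j a & cochain_map u a = cech_diff b.
  apply: chains_exact; first exact: chains_diff.
  by rewrite -cech_diff_map.
case: (pselect (cobound grA (p + 1) j a)); last first.
  move=> na; right; exists a; split=> //.
  apply: (cochain_map_inj0 (se_inj se)).
  by rewrite -cech_diff_map ua cech_diffK.
move=> [a' ha' def_a]; rewrite addrK in ha'.
left; exists (b - cochain_map u a'); split=> [||[b' hb' eb']].
- by apply: chainsB => //; exact: chains_map (se_u se) ha'.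
- by rewrite cech_diffB cech_diff_map -def_a ua subrr.
apply: nc; exists (cochain_map v b'); first exact: chains_v.
by rewrite cech_diff_map -eb' cochain_mapB cochain_vu subr0.
Qed.

End LongExact.

(** The setting: multiplication by f on N, with cokernel C, and a map pi : N -> B
    through which N -> C factors, where f kills C. *)

Section ConnectingFactors.
Context (N B C : lmodType R).
Context (grN : int -> set N) (grB : int -> set B) (grC : int -> set C).
Context (e : int) (f : R).
Context (u : {linear N -> N}) (w : {linear N -> C}).
Context (pi : {linear N -> B}) (v : {linear B -> C}).
Hypotheses (hN : grading x grN) (hB : grading x grB).
Hypothesis se : short_exact grN grN grC e u w.
Hypothesis uE : forall m, u m = f *: m.
Hypotheses (v_deg : maps_degree grB grC 0 v) (pi_deg : maps_degree grN grB 0 pi).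
Hypothesis v_pi : forall m, v (pi m) = w m.
Hypothesis f_deg : maps_degree grB grB e ( *:%R f).
Hypothesis f_C : forall c : C, f *: c = 0.

(** Lift the cocycle c of C to m in N; then d m = f m' for a cocycle m'. The
    class of pi m' in B is the image of that of c. When pi m' is a boundary d b,
    the cochain pi m - f b of B is a cocycle lifting c, because f b dies in C. *)
Lemma connecting_factors p j : cohom_neq0 x grC p (j + e) ->
  cohom_neq0 x grB p (j + e) \/ cohom_neq0 x grB (p + 1) j.
Proof.
move=> [c [/(chains_surj se)[m hm <-] dc nc]].
have chains_pi q i (m0 : cochain x N) :
    chains grN q i m0 -> chains grB q i (cochain_map pi m0).
  by rewrite -{2}[i]addr0; exact: chains_map.
have [m' hm' um'] : exists2 m', chains grN (p + 1) j m' &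
    cochain_map u m' = cech_diff m.
  apply: (chains_exact hN se); first exact: chains_diff.
  by rewrite -cech_diff_map.
rewrite (cochain_map_scale _ uE) in um'.
have dm' : cech_diff m' = 0.
  apply: (cochain_map_inj0 (se_inj se)).
  by rewrite (cochain_map_scale _ uE) -cech_diffZ um' cech_diffK.
case: (pselect (cobound grB (p + 1) j (cochain_map pi m'))); last first.
  move=> nb; right; exists (cochain_map pi m'); split=> //.
    exact: chains_pi.
  by rewrite cech_diff_map dm'; apply: (linear0 (cochain_map pi)).
move=> [b hb eb]; rewrite addrK in hb.
left; exists (cochain_map pi m - f *: b); split.
- by apply: chainsB => //; [exact: chains_pi|exact: chainsZ].
- by rewrite cech_diffB cech_diffZ -eb cech_diff_map -um' cochain_mapZ subrr.
move=> [b' hb' eb']; apply: nc; exists (cochain_map v b').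
  by rewrite -[j + e]addr0; exact: chains_map hb'.
rewrite cech_diff_map -eb' cochain_mapB cochain_mapZ (cochain_map_comp _ v_pi).
suff -> : f *: cochain_map v b = 0 by rewrite subr0.
apply/cochainP => S; rewrite cochainZ; elim/loc_ind: (cochain_map v b S) => t a.
by rewrite loc_fracZ f_C loc_frac0.
Qed.

End ConnectingFactors.

Section RegularElement.
Context (N C : lmodType R) (grN : int -> set N) (grC : int -> set C).
Context (d : nat) (f : R) (u : {linear N -> N}) (w : {linear N -> C}).
Hypothesis hN : grading x grN.
Hypothesis se : short_exact grN grN grC d%:Z u w.
Hypothesis uE : forall m, u m = f *: m.

(** Among the multiples f ^+ i c take the last one that is not a boundary: f
    maps its class to 0, so it comes from C through the connecting map. *)
Lemma cohom_quotient_of_torsion a p j (c : cochain x N) :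
  chains grN p j c -> cech_diff c = 0 -> ~ cobound grN p j c ->
  cobound grN p (j + (a * d)%N%:Z) (f ^+ a *: c) ->
  exists2 b, (0 < b)%N & cohom_neq0 x grC (p - 1) (j + (b * d)%N%:Z).
Proof.
elim: a j c => [|a IH] j c hc dc nc.
  by rewrite addr0 expr0 scale1r.
have fc : chains grN p (j + d%:Z) (f *: c).
  by rewrite -(cochain_map_scale _ uE); exact: chains_map (se_u se) hc.
case: (pselect (cobound grN p (j + d%:Z) (f *: c))) => [fb _|nfb].
  exists 1%N => //; rewrite mul1n.
  by apply: (les_connecting hN se hc dc nc); rewrite (cochain_map_scale _ uE).
rewrite exprSr -scalerA mulSn PoszD addrA => fac.
have [|b b0] := IH _ _ fc _ nfb fac; first by rewrite cech_diffZ dc scaler0.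
by rewrite -addrA -PoszD -mulSn => hb; exists b.+1.
Qed.

End RegularElement.
End ExactSequences.
Local Open Scope quotient_scope.

(** * Maps between quotients *)

Section QuotientMaps.
Context (R : comNzRingType) (V : lmodType R).
Implicit Types (P Q : submodClosed V) (a r : R) (v : V).

Lemma quot_piZ Q r v : r *: \pi_(quotmod Q) v = \pi_(quotmod Q) (r *: v).
Proof. exact: quot_scaleE. Qed.

Lemma quot_pi0 Q : \pi_(quotmod Q) (0 : V) = 0.
Proof. by rewrite -(scale0r (0 : V)) -quot_piZ scale0r. Qed.

Lemma quot_piB Q v v' :
  \pi_(quotmod Q) (v - v') = \pi_(quotmod Q) v - \pi_(quotmod Q) v'.
Proof. by rewrite quot_piD -scaleN1r -quot_piZ scaleN1r. Qed.

Lemma quot_pi_eq0 Q v : \pi_(quotmod Q) v = 0 <-> v \in Q.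
Proof.
rewrite -quot_pi0; split; first by move/quot_eqP; rewrite subr0.
by move=> vQ; apply/quot_eqP; rewrite subr0.
Qed.

(** Every map between the quotients at hand is multiplication by a scalar [a],
    either 1 or f. The proof is an argument so that linearity can be inferred. *)
Definition qmap P Q a of (forall v, v \in P -> a *: v \in Q) :
    quotmod P -> quotmod Q := fun z => \pi_(quotmod Q) (a *: repr z).

Lemma qmapE P Q a (h : forall v, v \in P -> a *: v \in Q) v :
  qmap h (\pi_(quotmod P) v) = \pi_(quotmod Q) (a *: v).
Proof.
apply/quot_eqP; rewrite -scalerBr; apply: h.
by apply/quot_eqP; rewrite reprK.
Qed.

Lemma qmap_linear P Q a (h : forall v, v \in P -> a *: v \in Q) :
  linear (qmap h).
Proof.
move=> r; elim/quotW=> v; elim/quotW=> v'.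
rewrite quot_piZ -quot_piD !qmapE quot_piZ -quot_piD.
by rewrite scalerDr !scalerA mulrC.
Qed.

HB.instance Definition _ P Q a (h : forall v, v \in P -> a *: v \in Q) :=
  GRing.isLinear.Build R (quotmod P) (quotmod Q) _ (qmap h) (qmap_linear h).

Definition full_pred : pred V := predT.

Lemma full_closed : submod_closed full_pred.
Proof. by []. Qed.

HB.instance Definition _ := GRing.isSubmodClosed.Build R V full_pred full_closed.

Definition submod_full : submodClosed V :=
  GRing.SubmodClosed.clone R V full_pred _.

Lemma submod_addP (P Q : submodClosed V) v :
  v \in submod_add P Q <-> exists u w, [/\ u \in P, w \in Q & v = u + w].
Proof. by split=> [/asboolP|h]; [|apply/asboolP]. Qed.

Lemma submod_scaleP (f : R) (P : submodClosed V) v :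
  v \in submod_scale f P <-> exists2 u, u \in P & v = f *: u.
Proof. by split=> [/asboolP|h]; [|apply/asboolP]. Qed.

Lemma submod_addl (P Q : submodClosed V) v : v \in P -> v \in submod_add P Q.
Proof. by move=> vP; apply/submod_addP; exists v, 0; rewrite rpred0 addr0. Qed.

End QuotientMaps.

(** * Local cohomology is torsion *)

Section PolynomialTorsion.
Context (k : fieldType) (n : nat).
Local Notation R := {mpoly k[n]}.
Local Notation x := (@mvar k n).

Definition homog_act (M : lmodType R) (gr : int -> set M) :=
  forall (e : nat) (p : R), p \is e.-homog -> maps_degree gr gr e%:Z ( *:%R p).

Context (M : lmodType R) (gr : int -> set M) (hgr : grading x gr).
Hypothesis act : homog_act gr.

Lemma mnm_large (m : 'X_{1..n}) L :
  (n * L < mdeg m)%N -> exists i : 'I_n, (L < m i)%N.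
Proof.
move=> h; apply: contrapT => hN; move: h; rewrite ltnNge => /negP; apply.
rewrite mdegE -[n in (n * L)%N]card_ord -sum_nat_const leq_sum // => i _.
by rewrite leqNgt; apply/negP => hi; apply: hN; exists i.
Qed.

(** By the pigeonhole principle every monomial of a high power of f is divisible
    by a high power of some variable, and such a power turns c into a boundary. *)
Lemma homog_torsion p j (c : cochain x M) (f : R) d :
  (0 < d)%N -> f \is d.-homog -> chains gr p j c -> cech_diff c = 0 ->
  exists a : nat, cobound gr p (j + (a * d)%N%:Z) (f ^+ a *: c).
Proof.
move=> d0 hf hc dc.
have [L hL] : exists L, forall i, cobound gr p (j + L%:Z) (x i ^+ L *: c).
  apply: (eventually_finite (P := fun i L => _)) => i.
  have [L0 hL0] := var_torsion hgr i hc dc.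
  exists L0 => L /subnK <-; rewrite [(_ + L0)%N]addnC PoszD addrA.
  by rewrite addnC exprD -scalerA; apply: coboundZ => //; exact: gr_Xn.
exists (n * L).+1; set a := _.+1.
have hfa : f ^+ a \is (a * d).-homog by rewrite mulnC; exact: dhomogMn.
rewrite [f ^+ a]mpolyE scaler_suml big_seq.
elim/big_rec: _ => [|m b mf]; first exact: cobound0.
apply: coboundD => //.
have dm : mdeg m = (a * d)%N by move/dhomogP: hfa; apply.
have [i Lm] : exists i : 'I_n, (L < m i)%N.
  by apply: mnm_large; rewrite dm /a mulSn; nia.
have leLm : (U_(i) *+ L <= m)%MM.
  apply/mnm_lepP => i'; rewrite mulmnE mnm1E.
  by case: eqP => [<-|]; rewrite ?mul1n ?mul0n // ltnW.
rewrite -(submK leLm) mpolyXD -mpolyXn scalerAl -scalerA.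
have -> : j + (a * d)%N%:Z = j + L%:Z + (mdeg (m - U_(i) *+ L))%:Z.
  have := congr1 mdeg (submK leLm).
  by rewrite mdegD mdegMn mdeg1 mul1n dm => <-; rewrite PoszD; lia.
apply: coboundZ (hL i); apply: act; apply: dhomogZ.
by rewrite dhomogX.
Qed.

End PolynomialTorsion.

(** * The grading of R/I *)

Section QuotientGrading.
Context (k : fieldType) (n : nat).
Local Notation R := {mpoly k[n]}.
Local Notation x := (@mvar k n).
Implicit Types (I P Q : submodClosed R^o).

Lemma quot_piece0 I j : quot_piece I j 0.
Proof.
exists 0; last by rewrite quot_pi0.
by case: j => [d|d]; rewrite ?rpred0.
Qed.

Lemma quot_piece_homog_act I : homog_act (quot_piece I).
Proof.
move=> e p hp j z [q hq ->]; rewrite quot_piZ.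
case: j hq => [d|d] hq.
  by exists (p * q) => //=; rewrite addnC; exact: dhomogM.
by rewrite (eqP hq) scaler0 quot_pi0; exact: quot_piece0.
Qed.

Lemma quot_piece_grading I : grading x (quot_piece I).
Proof.
split=> [j|j z z' [q hq ->] [q' hq' ->]|i]; first exact: quot_piece0.
  exists (q - q'); last by rewrite -quot_piB.
  by case: j hq hq' => [d|d] hq hq'; rewrite ?rpredB // (eqP hq) (eqP hq') subr0.
by apply: (@quot_piece_homog_act I 1); rewrite dhomogX /= mdeg1.
Qed.

Lemma quot_piece_qmap1 P Q (h : forall v, v \in P -> 1 *: v \in Q) :
  maps_degree (quot_piece P) (quot_piece Q) 0 (qmap h).
Proof.
by move=> j _ [q hq ->]; rewrite addr0; exists q => //; rewrite qmapE scale1r.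
Qed.

Lemma pihomog_mul (f r : R) d m : f \is d.-homog ->
  pihomog mdeg m (f * r) =
  if (d <= m)%N then f * pihomog mdeg (m - d) r else 0.
Proof.
move=> hf; have {1}-> := pihomog_partitionE (leq_maxl (mmeasure mdeg r) m.+1).
have piM i : pihomog mdeg m (f * pihomog mdeg i r) =
    if (d + i == m)%N then f * pihomog mdeg i r else 0.
  have hi : f * pihomog mdeg i r \is (d + i).-homog.
    by apply: dhomogM => //; exact: pihomogP.
  case: eqP => [<-|/eqP ne]; first exact: pihomog_dE.
  exact: pihomog_ne0 hi.
rewrite mulr_sumr raddf_sum /= (eq_bigr _ (fun (i : 'I__) _ => piM i)).
rewrite -big_mkcond /=; case: leqP => dm; last first.
  by rewrite big_pred0 // => i; apply/eqP => e; rewrite -e ltnNge leq_addr in dm.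
have hK : (m - d < maxn (mmeasure mdeg r) m.+1)%N.
  by rewrite leq_max ltnS leq_subr orbT.
rewrite (big_pred1 (Ordinal hK)) // => i /=.
by rewrite -val_eqE /= -[RHS](eqn_add2l d) subnKC.
Qed.

End QuotientGrading.

(** * The sequence R/P(-d) -> R/Q -> R/(J, f) *)

Section PrincipalSequence.
Context (k : fieldType) (n : nat).
Local Notation R := {mpoly k[n]}.
Local Notation x := (@mvar k n).
Context (J P Q : submodClosed R^o) (f : R).

Definition ideal_add_gen : submodClosed R^o :=
  submod_add J (submod_scale f (submod_full R^o)).

Lemma ideal_add_genP (p : R) :
  p \in ideal_add_gen <-> exists q r : R, q \in J /\ p = q + f * r.
Proof.
split=> [/submod_addP[q [_ [qJ /submod_scaleP[r _ ->] ->]]]|[q [r [qJ ->]]]].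
  by exists q, r.
apply/submod_addP; exists q, (f * r); split=> //.
by apply/submod_scaleP; exists r.
Qed.

(* [PQ] makes multiplication by f from R/P to R/Q well defined and injective. *)
Hypothesis PQ : forall r : R, r \in P <-> f *: (r : R^o) \in Q.
Hypothesis JQ : {subset J <= Q}.
Hypothesis QC : {subset Q <= ideal_add_gen}.

Lemma mul_PQ (r : R^o) : r \in P -> f *: r \in Q.
Proof. by move/PQ. Qed.

Lemma one_QC (r : R^o) : r \in Q -> 1 *: r \in ideal_add_gen.
Proof. by rewrite scale1r; exact: QC. Qed.

Lemma qmap_mul_inj z : qmap mul_PQ z = 0 -> z = 0.
Proof.
elim/quotW: z => r; rewrite qmapE => /quot_pi_eq0/PQ rP.
exact/quot_pi_eq0.
Qed.

Lemma qmap_one_mul z : qmap one_QC (qmap mul_PQ z) = 0.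
Proof.
elim/quotW: z => r; rewrite (qmapE mul_PQ) (qmapE one_QC); apply/quot_pi_eq0.
apply/ideal_add_genP; exists 0, r; split; first exact: rpred0.
by rewrite add0r scale1r.
Qed.

Lemma trivial_short_exact e : short_exact
  (fun=> setT) (fun=> setT) (fun=> setT) e (qmap mul_PQ) (qmap one_QC).
Proof.
split=> // [||j z _|j z _]; [exact: qmap_mul_inj|exact: qmap_one_mul| |].
  elim/quotW: z => p /=; rewrite qmapE scale1r.
  move=> /quot_pi_eq0/ideal_add_genP[q [r [qJ def_p]]].
  exists (\pi_(quotmod P) r) => //=; rewrite qmapE; apply/esym/quot_eqP.
  by rewrite def_p addrK; exact: JQ.
elim/quotW: z => p; exists (\pi_(quotmod Q) p) => //=.
by rewrite qmapE scale1r.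
Qed.

(** A homogeneous p in J + f R can be written q + f r with q and r homogeneous:
    take components, which stay in J because J is homogeneous. *)
Lemma graded_short_exact d : homogeneous_ideal J -> f \is d.-homog ->
  short_exact (quot_piece P) (quot_piece Q) (quot_piece ideal_add_gen) d%:Z
    (qmap mul_PQ) (qmap one_QC).
Proof.
move=> hJ hf; split.
- move=> j _ [q hq ->]; rewrite /= qmapE -quot_piZ.
  apply: quot_piece_homog_act => //.
  by exists q.
- exact: quot_piece_qmap1.
- exact: qmap_mul_inj.
- exact: qmap_one_mul.
- move=> j _ [p hp ->]; rewrite /= qmapE scale1r.
  move=> /quot_pi_eq0/ideal_add_genP[q [r [qJ def_p]]].
  have Jeq (s : R) : p - f * s \in J ->
      qmap mul_PQ (\pi_(quotmod P) s) = \pi_(quotmod Q) p.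
    by move=> h; rewrite /= qmapE; apply/esym/quot_eqP; exact: JQ.
  case def_t: (j + d%:Z) hp => [t|t] hp; last first.
    exists 0; first exact: quot_piece0.
    by rewrite (eqP hp) linear0 quot_pi0.
  have def_p_t : p = pihomog mdeg t q + pihomog mdeg t (f * r).
    by rewrite -pihomogD -def_p pihomog_dE.
  have qtJ : pihomog mdeg t q \in J by exact: hJ.
  rewrite (pihomog_mul _ _ hf) in def_p_t; case: leqP def_p_t => [dt|td] def_p_t.
    exists (\pi_(quotmod P) (pihomog mdeg (t - d) r)).
      have -> : j = (t - d)%N%:Z by lia.
      by exists (pihomog mdeg (t - d) r) => //; exact: pihomogP.
    by apply: Jeq; rewrite def_p_t addrK.
  exists 0; first exact: quot_piece0.
  by rewrite -quot_pi0; apply: Jeq; rewrite mulr0 subr0 def_p_t addr0.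
- move=> j _ [p hp ->]; exists (\pi_(quotmod Q) p); first by exists p.
  by rewrite /= qmapE scale1r.
Qed.

End PrincipalSequence.

(** * The sequences attached to J and H *)

(** The part of the long exact sequences that bounds depth and regularity, in
    terms of the sets of bidegrees where the cohomology of A = R/(J + H),
    B = R/(J + f H), C = R/(J + f R) and N = R/J does not vanish. *)
Record les_facts (d : nat) (HA HB HC HN : int -> int -> Prop) : Prop := {
  lesA : forall p j, HA p j -> HB p (j + d%:Z) \/ HC (p - 1) (j + d%:Z);
  lesB : forall p j, HB p (j + d%:Z) -> HA p j \/ HC p (j + d%:Z);
  lesC : forall p j, HC p (j + d%:Z) -> HB p (j + d%:Z) \/ HA (p + 1) j;
  lesCB : forall p j, HC p (j + d%:Z) -> HB p (j + d%:Z) \/ HB (p + 1) j;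
  lesCN : forall p j, HC p (j + d%:Z) -> HN p (j + d%:Z) \/ HN (p + 1) j;
  lesNC : forall p j, (0 < d)%N -> HN p j ->
    exists2 b, (0 < b)%N & HC (p - 1) (j + (b * d)%N%:Z);
  lesC0 : forall p j, d = 0%N -> ~ HC p j
}.

Section Facts.
Context (k : fieldType) (n : nat).
Local Notation R := {mpoly k[n]}.
Local Notation x := (@mvar k n).
Context (J H : submodClosed R^o) (d : nat) (f : R).
Hypothesis hf : f \is d.-homog.
Hypothesis hnzd : nonzerodivisor (quotmod J) f.
Local Notation A := (submod_add J H).
Local Notation B := (submod_add J (submod_scale f H)).
Local Notation C := (ideal_add_gen J f).

Lemma mem_mulJ (r : R) : r \in J <-> f *: (r : R^o) \in J.
Proof.
split=> [rJ|/quot_pi_eq0]; first exact: rpredZ.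
by rewrite -quot_piZ => /hnzd/quot_pi_eq0.
Qed.

(** If f r = q + f h with q in J, then f (r - h) is in J, hence r - h is. *)
Lemma mem_mulB (r : R) : r \in A <-> f *: (r : R^o) \in B.
Proof.
split=> [/submod_addP[q [h [qJ hH ->]]]|].
  apply/submod_addP; exists (f *: q), (f *: h); rewrite scalerDr.
  by split=> //; [exact: rpredZ|apply/submod_scaleP; exists h].
move=> /submod_addP[q [_ [qJ /submod_scaleP[h hH ->] e]]].
apply/submod_addP; exists (r - h : R^o), h; split=> //; last by rewrite subrK.
by apply/mem_mulJ; rewrite scalerBr e addrK.
Qed.

Lemma JJ : {subset J <= J}. Proof. by []. Qed.
Lemma JB : {subset J <= B}. Proof. by move=> v; exact: submod_addl. Qed.
Lemma JC : {subset J <= C}. Proof. by move=> v; exact: submod_addl. Qed.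

Lemma BC : {subset B <= C}.
Proof.
move=> v /submod_addP[q [_ [qJ /submod_scaleP[h _ ->] ->]]].
by apply/ideal_add_genP; exists q, h.
Qed.

Lemma mul_killC (z : quotmod C) : f *: z = 0.
Proof.
elim/quotW: z => r; rewrite quot_piZ; apply/quot_pi_eq0/ideal_add_genP.
by exists 0, r; split; [exact: rpred0|rewrite add0r].
Qed.

Lemma one_JB (v : R^o) : v \in J -> 1 *: v \in B.
Proof. by rewrite scale1r; exact: JB. Qed.

(** In degree 0 the form f is a constant: either a unit, or 0, in which case being
    a non-zerodivisor forces J to be the unit ideal. *)
Lemma quot_degree0_eq0 (z : quotmod C) : d = 0%N -> z = 0.
Proof.
move=> d0; have fE : f = (f@_0%MM)%:MP.
  apply/mpolyP => m; rewrite mcoeffC; have [->|m0] := eqVneq m 0%MM.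
    by rewrite mulr1.
  rewrite mulr0 memN_msupp_eq0 //; apply: contra m0 => mf.
  by rewrite -mdeg_eq0; move/dhomogP: hf => /(_ m mf) ->; rewrite d0.
elim/quotW: z => r; apply/quot_pi_eq0/ideal_add_genP.
have [f0|f0] := eqVneq f@_0%MM 0.
  exists r, 0; rewrite mulr0 addr0; split=> //; apply/quot_pi_eq0/hnzd.
  by rewrite fE f0 mpolyC0 scale0r.
exists 0, ((f@_0%MM)^-1 *: (r : R)); split; first exact: rpred0.
by rewrite add0r {1}fE mul_mpolyC scalerA divff // scale1r.
Qed.

(* The family [gr] is instantiated twice: with the graded pieces for the
   regularity, and with the constant family [setT] for the depth. *)
Context (gr : forall I : submodClosed R^o, int -> set (quotmod I)).
Hypothesis grP : forall I, grading x (@gr I).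
Hypothesis gr_act : forall I, homog_act (@gr I).
Hypothesis gr_one : forall (P Q : submodClosed R^o)
    (h : forall v, v \in P -> 1 *: v \in Q),
  maps_degree (@gr P) (@gr Q) 0 (qmap h).
Hypothesis gr_se : forall (P Q : submodClosed R^o)
  (PQ : forall r : R, r \in P <-> f *: (r : R^o) \in Q)
  (JQ : {subset J <= Q}) (QC : {subset Q <= C}),
  short_exact (@gr P) (@gr Q) (@gr C) d%:Z (qmap (mul_PQ PQ)) (qmap (one_QC QC)).

Lemma quotient_les : les_facts d
  (cohom_neq0 x (@gr A)) (cohom_neq0 x (@gr B))
  (cohom_neq0 x (@gr C)) (cohom_neq0 x (@gr J)).
Proof.
have seB := gr_se mem_mulB JB BC.
have seN := gr_se mem_mulJ JJ JC.
have mulE m : qmap (mul_PQ mem_mulJ) m = f *: m.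
  by elim/quotW: m => r; rewrite qmapE quot_piZ.
split.
- by move=> p j; exact: (les_A (grP B) seB).
- by move=> p j; exact: (les_B (grP B) seB).
- by move=> p j; exact: (les_C (grP B) seB).
- move=> p j; apply: (connecting_factors (grP J) (grP B) seN mulE
    (@gr_one _ _ (one_QC BC)) (@gr_one _ _ one_JB)).
  + by elim/quotW=> v; rewrite /= (qmapE one_JB) (qmapE (one_QC BC))
      (qmapE (one_QC JC)) scale1r.
  + exact: gr_act.
  + exact: mul_killC.
- by move=> p j; exact: (les_C (grP J) seN).
- move=> p j d0 [c [hc dc nc]].
  have [a ha] := homog_torsion (grP J) (@gr_act J) d0 hf hc dc.
  exact: (cohom_quotient_of_torsion (grP J) seN mulE hc dc nc ha).
move=> p j d0 [c [_ _ []]].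
have -> : c = 0.
  apply/cochainP => S; elim/loc_ind: (c S) => z t.
  by rewrite (quot_degree0_eq0 z d0) loc_frac0.
exact: cobound0.
Qed.

End Facts.

Import Order.TTheory Num.Theory.

(** * Least and greatest degrees in the extended integers *)

Section ExtendedIntegers.
Local Open Scope ereal_scope.

Lemma infimum_nat (X : nat -> Prop) :
  ((forall p, ~ X p) /\
     infimum +oo [set p%:Z%:E | p in [set p | X p]] = +oo) \/
  (exists2 p, X p & (forall q, X q -> (p <= q)%N) /\
     infimum +oo [set p%:Z%:E | p in [set p | X p]] = p%:Z%:E).
Proof.
case: (pselect (exists p, X p)) => [hX|nX]; last first.
  left; split=> [p Xp|]; first by apply: nX; exists p.
  rewrite /infimum ifT //; apply/eqP; rewrite -subset0 => y [p Xp _].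
  by case: nX; exists p.
right; have hX' : exists p, `[< X p >] by have [p Xp] := hX; exists p; apply/asboolP.
case: (ex_minnP hX') => p /asboolP Xp min_p; exists p => //.
have le_p q : X q -> (p <= q)%N by move=> Xq; apply/min_p/asboolP.
split=> //; set S := [set _ | _ in _].
have Sp : S p%:Z%:E by exists p.
have pS : lbound S p%:Z%:E by move=> y [q Xq <-]; rewrite lee_fin lez_nat le_p.
rewrite /infimum ifF; last by apply/eqP => S0; rewrite S0 in Sp.
apply/le_anti/andP.
have [|lS gS] := @xgetPex _ +oo (infimums S).
  by exists p%:Z%:E; split=> // y; apply.
by rewrite lS // gS.
Qed.

(** A bounded nonempty set of integers has a maximum, so the supremum is a true
    least upper bound in every case. *)
Lemma supremum_le (X : set int) (y : int) :
  supremum -oo [set v%:E | v in X] <= y%:E <-> forall v, X v -> (v <= y)%R.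
Proof.
set S := [set _ | _ in _].
have ubS z : ubound S z%:E <-> forall v, X v -> (v <= z)%R.
  split=> [h v Xv|h _ [v Xv <-]]; last by rewrite lee_fin h.
  by rewrite -lee_fin; apply: h; exists v.
have [S0|/set0P[s Ss]] := eqVneq S set0.
  rewrite /supremum ifT; last exact/eqP.
  split=> [_ v Xv|_]; last exact: leNye.
  have : S v%:E by exists v.
  by rewrite S0.
have sup_ex : supremums S !=set0.
  case: (pselect (exists z, ubound S z%:E)) => [[z /ubS zS]|nz]; last first.
    exists +oo; split=> [t _|t tS]; first exact: leey.
    case: t tS => [t||] tS //; first by case: nz; exists t.
    by have [v Xv ev] := Ss; have := tS _ Ss; rewrite -ev.
  have [v0 Xv0 _] := Ss.
  have hn : exists n : nat, `[< X (z - n%:Z)%R >].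
    exists `|z - v0|%N; apply/asboolP.
    by have -> : (z - `|z - v0|%N%:Z = v0)%R by have := zS _ Xv0; lia.
  case: (ex_minnP hn) => m /asboolP Xm min_m.
  exists (z - m%:Z)%:E; split=> [|t]; last by apply; exists (z - m%:Z)%R.
  apply/ubS => v Xv.
  have : (m <= `|z - v|)%N.
    apply/min_m/asboolP.
    by have -> : (z - `|z - v|%N%:Z = v)%R by have := zS _ Xv; lia.
  by have := zS _ Xv; lia.
rewrite /supremum ifF; last by apply/eqP => S0; rewrite S0 in Ss.
have [uS lS] := @xgetPex _ -oo (supremums S) sup_ex.
rewrite -ubS; split=> [h t St|/lS //].
exact: le_trans (uS _ St) h.
Qed.

(** The arithmetic of the regularity: b, a and r stand for the regularities of
    R/I, R/(J + H) and R/J. The hypotheses are stated on upper bounds because the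
    values may be infinite. If b exceeds r + d - 1, then r + d <= b, and the last
    two hypotheses pin b to a + d. *)
Lemma ereal_cut (d : nat) (a b r : \bar int) : (0 < d)%N ->
  (forall y : int, b <= y%:E -> r <= y%:E) ->
  (forall y : int, a <= (y - d%:Z)%:E -> r <= (y - d%:Z + 1)%:E -> b <= y%:E) ->
  (forall y : int, b <= y%:E -> r <= (y - d%:Z)%:E -> a <= (y - d%:Z)%:E) ->
  b = a + d%:Z%:E \/ exists2 e : nat, (e < d)%N & b = r + e%:Z%:E.
Proof.
move=> d0 rb ub lb.
have right0 : b = r -> exists2 e : nat, (e < d)%N & b = r + e%:Z%:E.
  by move=> ->; exists 0%N => //; rewrite adde0.
case: r rb ub lb right0 => [r||] rb ub lb right0.
- case: b rb ub lb right0 => [b||] rb ub lb right0.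
  + have rb' : (r <= b)%R by rewrite -lee_fin; exact: rb.
    have [lt_e|le_b] := ltP b (r + d%:Z)%R.
      right; exists `|b - r|%N; first lia.
      by rewrite -EFinD; congr _%:E; lia.
    left; case: a ub lb => [a||] ub lb.
    * have := lb b (lexx _); rewrite !lee_fin => h.
      have h1 : (a <= b - d%:Z)%R by apply: h; lia.
      have := ub (b - 1)%R; rewrite !lee_fin => h2.
      rewrite -EFinD; congr _%:E.
      have [?|?] := leP a (b - 1 - d%:Z)%R; last by lia.
      by have : (b <= b - 1)%R; [apply: h2; lia|lia].
    * have h : (r <= b - d%:Z)%R by lia.
      by have := lb b (lexx _); rewrite lee_fin => /(_ h).
    * have := ub (b - 1)%R; rewrite !lee_fin => h2.
      by have : (b <= b - 1)%R; [apply: h2; [exact: leNye|lia]|lia].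
  + left; case: a ub lb => [a||] ub lb //.
      have := ub (Num.max (a + d%:Z) (r + d%:Z))%R.
      rewrite !lee_fin => h; exfalso.
      by have : +oo <= (Num.max (a + d%:Z) (r + d%:Z))%R%:E; [apply: h; lia|].
    have := ub (r + d%:Z)%R; rewrite !lee_fin => h; exfalso.
    by have : +oo <= (r + d%:Z)%R%:E; [apply: h; [exact: leNye|lia]|].
  + by have := rb (r - 1)%R (leNye _); rewrite lee_fin; lia.
- right; apply: right0; case: b rb {ub lb} => [b||] rb //.
    by have := rb b (lexx _).
  by have := rb 0%R (leNye _).
- case: b rb ub lb right0 => [b||] rb ub lb right0.
  + left; case: a ub lb => [a||] ub lb.
    * have := lb b (lexx _) (leNye _); rewrite !lee_fin => h1.
      have := ub (b - 1)%R; rewrite !lee_fin => h2.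
      rewrite -EFinD; congr _%:E.
      have [?|?] := leP a (b - 1 - d%:Z)%R; last by lia.
      by have : (b <= b - 1)%R; [apply: h2; [lia|exact: leNye]|lia].
    * by have := lb b (lexx _) (leNye _).
    * have := ub (b - 1)%R (leNye _) (leNye _).
      by rewrite lee_fin; lia.
  + left; case: a ub lb => [a||] ub lb //.
      have := ub (a + d%:Z)%R; rewrite addrK => /(_ (lexx _) (leNye _)).
      by [].
    by have := ub 0%R (leNye _) (leNye _).
  + by right; exact: right0.
Qed.

Lemma ereal_ext (a b : \bar int) :
  (forall y : int, a <= y%:E <-> b <= y%:E) -> a = b.
Proof.
case: a b => [a||] [b||] // h.
- by congr _%:E; apply/le_anti; rewrite -!lee_fin (h b).2 // (h a).1.
- by have := (h a).1 (lexx _).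
- by have := (h (a - 1)%R).2 (leNye _); rewrite lee_fin; lia.
- by have := (h b).2 (lexx _).
- by have := (h 0%R).2 (leNye _).
- by have := (h (b - 1)%R).1 (leNye _); rewrite lee_fin; lia.
- by have := (h 0%R).1 (leNye _).
Qed.

Definition least_index (X : int -> Prop) (b : \bar int) : Prop :=
  ((forall p, ~ X p) /\ b = +oo) \/
  (exists p : nat, [/\ X p%:Z, forall q, X q -> (p%:Z <= q)%R & b = p%:Z%:E]).

(** The arithmetic of the depth, where a, b and r are those of R/(J + H), R/I and
    R/J. If B has no index, neither has C, nor A. Otherwise let p be the least index
    of B. If A lives at p, an index of A below p would come from C at an index
    below p - 1, but each index q of C gives an index q or q + 1 of B; so a = p.
    If not, C lives at p, and the least index of N can only be p + 1. *)
Lemma least_index_les d (HA HB HC HN : int -> Prop) (a b r : \bar int) :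
  least_index HA a -> least_index HB b -> least_index HN r ->
  (forall p, HA p -> HB p \/ HC (p - 1)%R) ->
  (forall p, HB p -> HA p \/ HC p) ->
  (forall p, HC p -> HB p \/ HA (p + 1)%R) ->
  (forall p, HC p -> HB p \/ HB (p + 1)%R) ->
  (forall p, HC p -> HN p \/ HN (p + 1)%R) ->
  (forall p, (0 < d)%N -> HN p -> HC (p - 1)%R) ->
  (forall p, HC p -> (0 <= p)%R) ->
  (forall p, d = 0%N -> ~ HC p) ->
  b = a \/ b = r - 1.
Proof.
move=> least_a least_b least_r lA lB lC lCB lCN lNC HC0 lC0.
case: least_b => [[nB ->]|[p [Bp minB ->]]].
  have nC q : ~ HC q by case/lCB => /nB.
  by left; case: least_a => [[_ ->] //|[q [/lA[/nB|/nC]]]].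
case: (pselect (HA p%:Z)) => Ap.
  left; case: least_a => [[/(_ p%:Z) []] //|[q [Aq minA ->]]].
  congr _%:E; apply/le_anti; rewrite (minA _ Ap) andbT.
  case: (lA _ Aq) => [/minB //|/lCB[/minB|/minB]]; lia.
have Cp : HC p%:Z by case: (lB _ Bp).
have d0 : (0 < d)%N by case: posnP (lC0 p%:Z) => // -> /(_ erefl Cp).
right; case: least_r => [[nN _]|[q [Nq minN ->]]]; first by case: (lCN _ Cp) => /nN.
rewrite -EFinB; congr _%:E.
have q_le : (q%:Z <= p%:Z + 1)%R by case: (lCN _ Cp) => /minN; lia.
have Cq := lNC _ d0 Nq.
have p_le : (p%:Z <= q%:Z)%R by case: (lCB _ Cq) => /minB; lia.
suff : p%:Z <> q%:Z by lia.
move=> epq; case: (lC _ Cq) => [/minB|]; first by lia.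
by rewrite subrK -epq.
Qed.

End ExtendedIntegers.

(** * Depth and regularity *)

Section DepthAndRegularity.
Context (k : fieldType) (n : nat).
Local Notation R := {mpoly k[n]}.
Local Notation x := (@mvar k n).

Lemma depthP (M : lmodType R) (X := cohom_neq0 x (fun=> [set: M])) :
  least_index (fun p => X p 0) (depth M).
Proof.
have HX (p : nat) : local_cohomology_neq0 x M p <-> X p%:Z 0.
  apply: cohom_neq0P => S; apply/seteqP; split=> // z _.
  by elim/loc_ind: z => m a; exists m, a.
rewrite /depth; have [[nH ->]|[p Hp [le_p ->]]] := infimum_nat (local_cohomology_neq0 x M).
  left; split=> // p Xp; have := cohom_neq0_ge0 Xp.
  by case: p Xp => // p /HX/nH.
right; exists p; split=> //; first exact/HX.
move=> q Xq; have := cohom_neq0_ge0 Xq.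
by case: q Xq => // q /HX/le_p.
Qed.

Lemma reg_le (M : lmodType R) (gr : int -> set M) (y : int) :
  (reg gr <= y%:E)%E <-> forall p j, cohom_neq0 x gr p j -> p + j <= y.
Proof.
pose X (v : int) := exists (p : nat) j,
  local_cohomology_piece_neq0 x gr p j /\ v = p%:Z + j.
have -> : reg gr = supremum -oo%E [set v%:E%E | v in X].
  congr supremum; apply/seteqP; split=> [_ [p [j [h ->]]]|_ [_ [p [j [h ->]]] <-]].
    by exists (p%:Z + j) => //; exists p, j.
  by exists p, j.
have HX p j : local_cohomology_piece_neq0 x gr p j <-> cohom_neq0 x gr p%:Z j.
  exact: cohom_neq0P.
rewrite supremum_le; split=> [h p j Xp|h _ [p [j [/HX hp ->]]]]; last exact: h.
have := cohom_neq0_ge0 Xp; case: p Xp => // p Xp _.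
by apply: h; exists p, j; split=> //; apply/HX.
Qed.

Lemma depth_of_les d (A B C N : lmodType R) :
  les_facts d (cohom_neq0 x (fun=> [set: A])) (cohom_neq0 x (fun=> [set: B]))
    (cohom_neq0 x (fun=> [set: C])) (cohom_neq0 x (fun=> [set: N])) ->
  depth B = depth A \/ depth B = (depth N - 1)%E.
Proof.
move=> [lA lB lC lCB lCN lNC lC0].
apply: (least_index_les (d := d) (@depthP A) (@depthP B) (@depthP N)
  (fun p => lA p 0) (fun p => lB p 0) (fun p => lC p 0) (fun p => lCB p 0)
  (fun p => lCN p 0)) => [p d0 /(lNC p 0 d0)[b _ //]|p|p d0].
  exact: cohom_neq0_ge0.
exact: lC0.
Qed.

Lemma reg_of_les d (A B C N : lmodType R) grA grB grC grN :
  les_facts d (@cohom_neq0 _ _ x A grA) (@cohom_neq0 _ _ x B grB)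
    (@cohom_neq0 _ _ x C grC) (@cohom_neq0 _ _ x N grN) ->
  reg grB = (reg grA + d%:Z%:E)%E \/
  exists2 e : nat, (e < d)%N & reg grB = (reg grN + e%:Z%:E)%E.
Proof.
move=> [lA lB lC lCB lCN lNC lC0].
(* the same facts, indexed by the degree of their hypothesis *)
have {}lA p j : cohom_neq0 x grA p j -> cohom_neq0 x grB p (j + d%:Z) \/
  cohom_neq0 x grC (p - 1) (j + d%:Z) by exact: lA.
have {}lB p j : cohom_neq0 x grB p j -> cohom_neq0 x grA p (j - d%:Z) \/
  cohom_neq0 x grC p j by move: (lB p (j - d%:Z)); rewrite subrK.
have {}lCB p j : cohom_neq0 x grC p j -> cohom_neq0 x grB p j \/
  cohom_neq0 x grB (p + 1) (j - d%:Z) by move: (lCB p (j - d%:Z)); rewrite subrK.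
have {}lCN p j : cohom_neq0 x grC p j -> cohom_neq0 x grN p j \/
  cohom_neq0 x grN (p + 1) (j - d%:Z) by move: (lCN p (j - d%:Z)); rewrite subrK.
have [d0|d0] := posnP d.
  left; rewrite d0 adde0; apply: ereal_ext => y; rewrite !reg_le d0 in lA lB lC0 *.
  split=> h p j Xp.
    by case: (lA p j Xp) => [|/lC0 []] //; rewrite addr0; exact: h.
  by case: (lB p j Xp) => [|/lC0 []] //; rewrite subr0; exact: h.
apply: ereal_cut => // y; rewrite !reg_le.
(* a multiple b * d of d with b > 0 only helps, as it is at least d *)
- move=> hB p j /(lNC p j d0)[b b0 hC].
  have db : (d <= b * d)%N by rewrite leq_pmull.
  by case: (lCB _ _ hC) => /hB; lia.
- move=> hA hN p j /lB[/hA|/lCN[/hN|/hN]]; lia.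
- move=> hB hN p j /lA[/hB|/lCN[/hN|/hN]]; lia.
Qed.

End DepthAndRegularity.

Local Open Scope ereal_scope.

Theorem corollary3p2 (k : fieldType) (n : nat)
    (J H : submodClosed {mpoly k[n]}^o)
    (hJ : homogeneous_ideal J) (hH : homogeneous_ideal H)
    (d : nat) (f : {mpoly k[n]}) (hf : f \is d.-homog)
    (hnzd : nonzerodivisor (quotmod J) f) :
  let I := submod_add J (submod_scale f H) in
  (depth (quotmod I) = depth (quotmod (submod_add J H)) \/
   depth (quotmod I) = depth (quotmod J) - 1) /\
  (reg (quot_piece I) = reg (quot_piece (submod_add J H)) + d%:Z%:E \/
   exists2 e : nat, (e < d)%N &
     reg (quot_piece I) = reg (quot_piece J) + e%:Z%:E).
Proof.
split.
  apply: depth_of_les.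
  apply: (@quotient_les k n J H d f hf hnzd (fun I _ => [set: quotmod I])) => //.
  by move=> *; exact: trivial_short_exact.
apply: reg_of_les.
apply: (@quotient_les k n J H d f hf hnzd (@quot_piece k n)).
- exact: quot_piece_grading.
- exact: quot_piece_homog_act.
- exact: quot_piece_qmap1.
- by move=> *; exact: graded_short_exact.
Qed.
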